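(* Let $N^{2n}$ and $P^{2p}$ be complex manifolds (of real dimensions $2n$, $2p$) and $M^{2(n+p)}$ an oriented Riemannian manifold. Denote by $\pi_1:N\times P\to N$ the projection onto the first factor. Assume that we have a $\mathcal{J}^1$-holomorphic map $$H:W\subseteq N\times P\to\Sigma^+M,\qquad(z,\xi)\mapsto H(z,\xi),$$ defined on some open subset $W$, such that (i) for each $z$, the map $P\ni\xi\mapsto H(z,\xi)\in\Sigma^+M$ is horizontal on its domain; (ii) the map $h=\pi\circ H$ is a diffeomorphism onto its image. Then the map $\pi_1\circ h^{-1}:h(W)\subseteq M\to N$ is holomorphic and has superminimal fibres with respect to the Hermitian structure on $h(W)$ defined by the section $H\circ h^{-1}$ of $\Sigma^+M$. In particular, when $n=1$, $\pi_1\circ h^{-1}$ is a harmonic morphism.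
   Context: Twistor space: $\pi:\Sigma^+M\to M$ is the bundle whose fibre at $x$ is the set of orthogonal $J:T_xM\to T_xM$ with $J^2=-\mathrm{Id}$ that are positive (bases $\{e_1,Je_1,\dots,e_k,Je_k\}$ are positively oriented). The Levi-Civita connection on $\mathrm{End}(TM)\supseteq\Sigma^+M$ gives $T\Sigma^+M=\mathcal{H}\oplus\mathcal{V}$ (horizontal and vertical parts) with $\mathcal{V}=\ker\mathrm{d}\pi$, $\mathcal{V}_{(x,J)}=\{\lambda\in\mathfrak{so}(T_xM):\lambda J=-J\lambda\}$. $\mathcal{J}^1$ is the almost complex structure equal to $(\mathrm{d}\pi|_{\mathcal{H}})^{-1}\circ J\circ\mathrm{d}\pi|_{\mathcal{H}}$ on $\mathcal{H}_{(x,J)}$ and to $\lambda\mapsto J\circ\lambda$ on $\mathcal{V}_{(x,J)}$. A map into $\Sigma^+M$ is horizontal if its differential takes values in $\mathcal{H}$. A section of $\Sigma^+M$ over an open set defines an almost Hermitian structure there. An almost complex submanifold $F$ of an almost Hermitian manifold $(M,g,J)$ is superminimal if $\nabla^M_XJ=0$ for all $X\in TF$. A harmonic morphism is a smooth map which pulls back locally defined harmonic functions on the codomain to locally defined harmonic functions on the domain; for maps into a Riemann surface this notion depends only on the conformal class of a Hermitian metric on the codomain, hence only on its complex structure. *)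

(* Defs.v *)
From HB Require Import structures.
From mathcomp Require Import all_boot all_order all_algebra.
From mathcomp Require Import all_classical all_reals all_analysis.
Set Implicit Arguments.
Unset Strict Implicit.
Unset Printing Implicit Defensive.
Import Order.TTheory GRing.Theory Num.Theory.
Import numFieldNormedType.Exports.
Local Open Scope classical_set_scope.
Local Open Scope ring_scope.

(** Smooth manifolds are topological spaces with an atlas valued in column
    vectors ['cV[R]_d].  An atlas comes with a chosen ("preferred") chart
    [chart_at x] around each point, and [T_x] is identified with ['cV[R]_d]
    by [chart_at x].  Hence tangent vectors at [x] are column vectors,
    endomorphisms and bilinear forms on [T_x] are [d x d] matrices (always
    relative to [chart_at x], which may jump with [x]; smoothness is
    therefore always tested in fixed charts), and differentials of maps
    are matrices acting on the left.

    Maps are total functions; only their values on the indicated set matter. *)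

Section Calculus.
Variable R : realType.

Fixpoint Ck (k : nat) (V W : normedModType R) (U : set V) (f : V -> W) : Prop :=
  match k with
  | 0%N => forall x, U x -> {for x, continuous f}
  | k'.+1 => (forall x, U x -> differentiable f x) /\
             (forall v, Ck k' U (fun x => 'D_v f x))
  end.

Definition smooth_on (V W : normedModType R) (U : set V) (f : V -> W) : Prop :=
  forall k, Ck k U f.

Definition ebasis (d : nat) (i : 'I_d) : 'cV[R]_d := delta_mx i 0.

Definition jac (d e : nat) (f : 'cV[R]_d -> 'cV[R]_e) (x : 'cV[R]_d) :
    'M[R]_(e, d) :=
  \matrix_(i < e, j < d) ('d f x (ebasis j)) i 0.

End Calculus.

Section Manifolds.
Variable R : realType.

(** [cinv] is meaningful only on the image [cmap @` cdom]. *)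
Record chart (d : nat) (T : Type) := Chart {
  cdom : set T;
  cmap : T -> 'cV[R]_d;
  cinv : 'cV[R]_d -> T }.

Record atlas (d : nat) (T : Type) := Atlas {
  charts : set (chart d T);
  chart_at : T -> chart d T }.

Definition transition (d : nat) (T : Type) (c c' : chart d T) (x : T) :
    'M[R]_d :=
  jac (cmap c' \o cinv c) (cmap c x).

Definition is_manifold (d : nat) (T : topologicalType) (A : atlas d T) : Prop :=
  [/\ hausdorff_space T,
      @second_countable T,
      forall x, charts A (chart_at A x) /\ cdom (chart_at A x) x,
      forall c, charts A c ->
        [/\ open (cdom c),
            open (cmap c @` cdom c),
            forall x, cdom c x -> cinv c (cmap c x) = x,
            forall x, cdom c x -> {for x, continuous (cmap c)} &
            forall y, (cmap c @` cdom c) y -> {for y, continuous (cinv c)}] &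
      forall c c', charts A c -> charts A c' ->
        smooth_on (cmap c @` (cdom c `&` cdom c')) (cmap c' \o cinv c)].

(** An orientation is given by an atlas with positive transition
    Jacobians; a basis of [T_x] is positive if its matrix in [chart_at x]
    has positive determinant. *)
Definition oriented_atlas (d : nat) (T : Type) (A : atlas d T) : Prop :=
  forall c c' x, charts A c -> charts A c' -> cdom c x -> cdom c' x ->
    0 < \det (transition c c' x).

Definition smooth_map (d e : nat) (S T : Type) (A : atlas d S) (B : atlas e T)
    (W : set S) (f : S -> T) : Prop :=
  forall c c', charts A c -> charts B c' ->
    let U := cmap c @` (W `&` cdom c `&` f @^-1` cdom c') in
    open U /\ smooth_on U (cmap c' \o f \o cinv c).

Definition smooth_fun (d : nat) (T : Type) (A : atlas d T) (W : set T)
    (u : T -> R) : Prop :=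
  forall c, charts A c ->
    smooth_on (cmap c @` (W `&` cdom c)) (u \o cinv c : 'cV[R]_d -> R^o).

Definition mdiff (d e : nat) (S T : Type) (A : atlas d S) (B : atlas e T)
    (f : S -> T) (x : S) : 'M[R]_(e, d) :=
  jac (cmap (chart_at B (f x)) \o f \o cinv (chart_at A x))
      (cmap (chart_at A x) x).

Definition diffeo_onto_image (d e : nat) (S : Type) (T : topologicalType)
    (A : atlas d S) (B : atlas e T) (W : set S) (f : S -> T) (finv : T -> S) :
    Prop :=
  [/\ smooth_map A B W f,
      open (f @` W),
      smooth_map B A (f @` W) finv &
      forall w, W w -> finv (f w) = w].

Definition euclid (d : nat) : atlas d 'cV[R]_d :=
  let c := Chart setT idfun idfun in Atlas [set c] (fun=> c).

Definition prod_chart (d e : nat) (S T : Type) (c : chart d S)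
    (c' : chart e T) : chart (d + e) (S * T) :=
  Chart [set z | cdom c z.1 /\ cdom c' z.2]
        (fun z => col_mx (cmap c z.1) (cmap c' z.2))
        (fun y => (cinv c (usubmx y), cinv c' (dsubmx y))).

Definition prod_atlas (d e : nat) (S T : Type) (A : atlas d S)
    (B : atlas e T) : atlas (d + e) (S * T) :=
  Atlas [set cc | exists c c', [/\ charts A c, charts B c' &
                                   cc = prod_chart c c']]
        (fun z => prod_chart (chart_at A z.1) (chart_at B z.2)).

(** [R^n + i R^n]: multiplication by [i] maps [(x, y)] to [(-y, x)]. *)
Definition J0 (n : nat) : 'M[R]_(n + n) := block_mx 0 (- 1%:M) 1%:M 0.

(** Transition maps satisfy the Cauchy-Riemann equations, so that [J0 n] is
    the complex structure of every [T_z], whatever the chart. *)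
Definition complex_manifold (n : nat) (T : topologicalType)
    (A : atlas (n + n) T) : Prop :=
  is_manifold A /\
  forall c c' x, charts A c -> charts A c' -> cdom c x -> cdom c' x ->
    transition c c' x *m J0 n = J0 n *m transition c c' x.

Definition prodJ (n p : nat) : 'M[R]_((n + n) + (p + p)) :=
  block_mx (J0 n) 0 0 (J0 p).

Definition holomorphic (d e : nat) (S T : Type) (A : atlas d S) (B : atlas e T)
    (JA : S -> 'cV[R]_d -> 'cV[R]_d) (JB : T -> 'cV[R]_e -> 'cV[R]_e)
    (W : set S) (f : S -> T) : Prop :=
  smooth_map A B W f /\
  forall x v, W x -> mdiff A B f x *m JA x v = JB (f x) (mdiff A B f x *m v).

End Manifolds.

Section Riemannian.
Variables (R : realType) (d : nat) (T : Type) (A : atlas R d T).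
Variable g : T -> 'M[R]_d.

Definition metric_in (c : chart R d T) (y : 'cV[R]_d) : 'M[R]_d :=
  let x := cinv c y in
  let D := transition c (chart_at A x) x in
  D^T *m g x *m D.

Definition riemannian_metric : Prop :=
  [/\ forall x, (g x)^T = g x,
      forall x (v : 'cV[R]_d), v != 0 -> 0 < (v^T *m g x *m v) 0 0 &
      forall c, charts A c -> smooth_on (cmap c @` cdom c) (metric_in c)].

(** Christoffel symbol [Gamma^k_ij] of the Levi-Civita connection at the point
    of coordinates [y] in the chart [c]. *)
Definition christoffel (c : chart R d T) (y : 'cV[R]_d) (k i j : 'I_d) : R :=
  let G := metric_in c in
  let dG (a b e : 'I_d) := 'D_(ebasis R a) G y b e in
  2^-1 * \sum_(l < d) invmx (G y) k l * (dG i j l + dG j i l - dG l i j).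

(** The endomorphism [Y |-> X^i Y^j Gamma^k_ij] of [T_x]. *)
Definition gamma (x : T) (X : 'cV[R]_d) : 'M[R]_d :=
  let c := chart_at A x in
  \matrix_(k < d, j < d) \sum_(i < d) X i 0 * christoffel c (cmap c x) k i j.

(** The total space of [End(TT)] is [T * 'M[R]_d]; [(x, L)] stands for the
    endomorphism [L] of [T_x].  A chart [c] of [T] induces the chart
    [(x, L) |-> (coordinates of x, matrix of L in the frame of c)]. *)
Definition end_chart (c : chart R d T) : chart R (d + d * d) (T * 'M[R]_d) :=
  let D x := transition c (chart_at A x) x in
  Chart [set z | cdom c z.1]
        (fun z => col_mx (cmap c z.1)
                         (mxvec (invmx (D z.1) *m z.2 *m D z.1))^T)
        (fun y => let x := cinv c (usubmx y) in
                  (x, D x *m vec_mx (dsubmx y)^T *m invmx (D x))).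

Definition end_atlas : atlas R (d + d * d) (T * 'M[R]_d) :=
  Atlas (end_chart @` charts A) (fun z => end_chart (chart_at A z.1)).

(** A tangent vector of [End(TT)] at [(x, L)] has coordinates [(X, L')] in the
    chart induced by [chart_at A x].  [dpi] is the differential [X] of the
    projection, and [vert] the connection map [L' + [Gamma(X), L]] of the
    Levi-Civita connection on [End(TT)]: it is the projection onto
    [ker dpi = End(T_x)] along the horizontal space. *)
Definition dpi (v : 'cV[R]_(d + d * d)) : 'cV[R]_d := usubmx v.

Definition vert (z : T * 'M[R]_d) (v : 'cV[R]_(d + d * d)) : 'M[R]_d :=
  let Gam := gamma z.1 (dpi v) in
  vec_mx (dsubmx v)^T + (Gam *m z.2 - z.2 *m Gam).

Definition horizontal_space (z : T * 'M[R]_d) : set 'cV[R]_(d + d * d) :=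
  [set v | vert z v = 0].

Definition hlift (z : T * 'M[R]_d) (X : 'cV[R]_d) : 'cV[R]_(d + d * d) :=
  let Gam := gamma z.1 X in
  col_mx X (mxvec (z.2 *m Gam - Gam *m z.2))^T.

Definition vlift (L : 'M[R]_d) : 'cV[R]_(d + d * d) :=
  col_mx 0 (mxvec L)^T.

(** For every family [e] such that the vectors
    [e 0, J (e 0), e 1, J (e 1), ...] form a basis, this basis is positive. *)
Definition positive (J : 'M[R]_d) : Prop :=
  forall e : nat -> 'cV[R]_d,
    let B : 'M[R]_d := \matrix_(r < d, s < d)
      (if odd s then J *m e s./2 else e s./2) r 0 in
    B \in unitmx -> 0 < \det B.

Definition orthogonal_at (x : T) (J : 'M[R]_d) : Prop :=
  J^T *m g x *m J = g x.

Definition twistor : set (T * 'M[R]_d) :=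
  [set z | [/\ orthogonal_at z.1 z.2, z.2 *m z.2 = - 1%:M & positive z.2]].

(** The almost complex structure of the twistor space, at a point [z = (x, J)]:
    [J] on the horizontal part and [L |-> J o L] on the vertical part.  The
    tangent space of [twistor] is a subspace of that of [End(TT)]; the formula
    makes sense on the latter. *)
Definition J1 (z : T * 'M[R]_d) (v : 'cV[R]_(d + d * d)) :
    'cV[R]_(d + d * d) :=
  hlift z (z.2 *m dpi v) + vlift (z.2 *m vert z v).

(** Smooth maps into the twistor space, an embedded submanifold of [End(TT)]. *)
Definition J1_holomorphic (e : nat) (S : Type) (B : atlas R e S)
    (JB : S -> 'cV[R]_e -> 'cV[R]_e) (W : set S) (H : S -> T * 'M[R]_d) :
    Prop :=
  (forall w, W w -> twistor (H w)) /\ holomorphic B end_atlas JB J1 W H.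

Definition horizontal_map (e : nat) (S : Type) (B : atlas R e S) (W : set S)
    (H : S -> T * 'M[R]_d) : Prop :=
  forall x (v : 'cV[R]_e), W x ->
    horizontal_space (H x) (mdiff B end_atlas H x *m v).

(** Covariant derivative [nabla_X L] at [x] of a field of endomorphisms. *)
Definition nabla (L : T -> 'M[R]_d) (x : T) (X : 'cV[R]_d) : 'M[R]_d :=
  vert (x, L x) (mdiff A end_atlas (fun y => (y, L y)) x *m X).

Definition almost_hermitian (U : set T) (J : T -> 'M[R]_d) : Prop :=
  smooth_map A end_atlas U (fun x => (x, J x)) /\
  forall x, U x -> J x *m J x = - 1%:M /\ orthogonal_at x (J x).

Definition laplacian (u : T -> R) (x : T) : R :=
  let c := chart_at A x in
  let y := cmap c x in
  let uc : 'cV[R]_d -> R^o := u \o cinv c in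
  \sum_(i < d) \sum_(j < d) invmx (metric_in c y) i j *
    ('D_(ebasis R i) (fun y' => 'D_(ebasis R j) uc y') y -
     \sum_(k < d) christoffel c y k i j * 'D_(ebasis R k) uc y).

Definition harmonic_on (U : set T) (u : T -> R) : Prop :=
  smooth_fun A U u /\ forall x, U x -> laplacian u x = 0.

End Riemannian.

Section Submanifolds.
Variables (R : realType) (d : nat) (T : topologicalType) (A : atlas R d T).

(** Embedded submanifold of codimension [r]: locally the zero set of a
    submersion to [R^r]. *)
Definition submanifold (r : nat) (F : set T) : Prop :=
  forall x, F x -> exists (V : set T) (s : T -> 'cV[R]_r),
    [/\ open V, V x,
        smooth_map A (euclid R r) V s,
        forall y, V y -> \rank (mdiff A (euclid R r) s y) = r &
        F `&` V = [set y | V y /\ s y = 0]].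

(** Velocities at [x] of smooth curves lying in [F]. *)
Definition tangent_space (F : set T) (x : T) : set 'cV[R]_d :=
  [set X | exists (eps : R) (gam : R -> T),
    let c := chart_at A x in
    [/\ 0 < eps, gam 0 = x,
        forall t, `|t| < eps -> F (gam t) /\ cdom c (gam t),
        smooth_on [set t : R^o | `|t| < eps] (cmap c \o gam : R^o -> 'cV[R]_d) &
        derive1 (cmap c \o gam) 0 = X]].

Variable g : T -> 'M[R]_d.

Definition superminimal (J : T -> 'M[R]_d) (F : set T) : Prop :=
  [/\ exists r, submanifold r F,
      forall x X, F x -> tangent_space F x X ->
        tangent_space F x (J x *m X) &
      forall x X, F x -> tangent_space F x X -> nabla A g J x X = 0].

Definition harmonic_morphism (e : nat) (S : topologicalType)
    (B : atlas R e S) (k : S -> 'M[R]_e) (U : set T) (f : T -> S) : Prop :=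
  smooth_map A B U f /\
  forall (V : set S) (u : S -> R), open V -> harmonic_on B k V u ->
    harmonic_on A g (U `&` f @^-1` V) (u \o f).

End Submanifolds.

(** Almost Hermitian, and integrable: around each point there are holomorphic
    coordinates in [C^m]. *)
Definition hermitian_structure (R : realType) (m : nat) (T : topologicalType)
    (A : atlas R (m + m) T) (g : T -> 'M[R]_(m + m)) (U : set T)
    (J : T -> 'M[R]_(m + m)) : Prop :=
  almost_hermitian A g U J /\
  forall x, U x -> exists (V : set T) (phi : T -> 'cV[R]_(m + m)) phiinv,
    [/\ open V, V x, V `<=` U,
        diffeo_onto_image A (euclid R (m + m)) V phi phiinv &
        holomorphic A (euclid R (m + m)) (fun y v => J y *m v)
          (fun _ v => J0 R m *m v) V phi].

(* Main.v *)
Require Import Defs.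
From HB Require Import structures.
From mathcomp Require Import all_boot all_order all_algebra.
From mathcomp Require Import ring.
From mathcomp Require Import all_classical all_reals all_analysis.
Import Order.TTheory GRing.Theory Num.Theory.
Import numFieldNormedType.Exports.
Local Open Scope classical_set_scope.
Local Open Scope ring_scope.

(** Let [sigma = H o h^-1] be the section [x |-> (x, J x)].  The almost complex
    structure of the twistor space has a horizontal and a vertical part, and so
    has the assumption that [H] is holomorphic.

    The horizontal part says that [h] intertwines the complex structure of
    [N x P] with [J].  Hence complex coordinates of [N x P], read through
    [h^-1], are coordinates adapted to [J], which is therefore integrable
    ([section_hermitian]), and [f = pi_1 o h^-1] is holomorphic
    ([projection_holomorphic]).

    The vertical part says that [nabla_(JX) J = J o nabla_X J]
    ([nabla_holomorphic]).  Moreover a fibre of [f] is the image under [h] of a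
    slice [{z} x P], along which [sigma] is the horizontal map [H (z, -)]; so
    [nabla_X J = 0] for [X] tangent to the fibre ([nabla_vertical]).  As the
    tangent space of the fibre is the kernel of the complex linear map [df], it
    is invariant under [J], and the fibres are superminimal
    ([fibre_superminimal]).

    Now let [N] be a surface.  In charts, [df] commutes with the complex
    structures, and [J] is orthogonal, so [df] is conformal on the horizontal
    space ([horizontally_conformal]).  By the chain rule the Laplacian of
    [u o f] is then a multiple of the flat Laplacian of [u], plus the derivative
    of [u] along the tension field of [f].  A Hermitian metric on a surface is
    conformal to the flat one, which has the same harmonic functions
    ([conformal_laplacian]), so it remains to see that the tension field
    vanishes ([tension_eq0]).  Let [B] be the second fundamental form of [f].
    Differentiating the equation [J0 o df = df o J] gives
      [J0 B(v, w) = B(v, J w) + df ((nabla_v J) w)].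
    Replace [w] by [J w] and take the trace.  The term [B(v, J w)] of the
    identity becomes the tension field; the term on the left has trace zero,
    since [B] is symmetric and [J] is skew.  What remains is [df] of the sum of
    the vectors [(nabla_e J) (J e)] over an orthonormal frame.  The vectors
    tangent to the fibre contribute nothing, and over a horizontal frame
    [X], [J X] the sum reduces, by [nabla_(JX) J = J o nabla_X J], to a multiple
    of [J (nabla_X J) X].  This vector is vertical: [nabla_X J] is skew and
    anticommutes with [J], so [(nabla_X J) X] is orthogonal to [X] and [J X]
    ([proj_nabla_XX]). *)

Set Implicit Arguments.
Unset Strict Implicit.
Unset Printing Implicit Defensive.

(** * Differentiable and smooth maps between normed spaces *)

Section Linear.
Variable R : realType.

Lemma matrix_delta_sum (W : lmodType R) m n (f : {linear 'M[R]_(m, n) -> W}) M :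
  f M = \sum_i \sum_j M i j *: f (delta_mx i j).
Proof.
rewrite [in LHS](matrix_sum_delta M) linear_sum; apply: eq_bigr => i _.
by rewrite linear_sum; apply: eq_bigr => j _; rewrite linearZ.
Qed.

Lemma differentiable_bigsum (V W : normedModType R) (I : Type) (r : seq I)
    (f : I -> V -> W) (x : V) :
  (forall i, differentiable (f i) x) ->
  differentiable (fun y => \sum_(i <- r) f i y) x.
Proof.
move=> df; elim: r => [|i r IH].
  rewrite (_ : (fun _ => _) = cst 0); first exact: differentiable_cst.
  by apply/funext => y; rewrite big_nil.
rewrite (_ : (fun _ => _) = f i + (fun y => \sum_(j <- r) f j y)).
  exact: differentiableD.
by apply/funext => y; rewrite big_cons.
Qed.

Lemma linear_mx_differentiable (W : normedModType R) m n
    (f : {linear 'M[R]_(m, n) -> W}) x : differentiable f x.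
Proof.
rewrite (_ : (f : _ -> _) = (fun M => \sum_i \sum_j M i j *: f (delta_mx i j))).
  apply: differentiable_bigsum => i; apply: differentiable_bigsum => j.
  exact/differentiableZl/differentiable_coord.
by apply/funext => M; exact: matrix_delta_sum.
Qed.

Lemma linear_mx_continuous (W : normedModType R) m n
    (f : {linear 'M[R]_(m, n) -> W}) : continuous f.
Proof.
by move=> x; apply: differentiable_continuous; exact: linear_mx_differentiable.
Qed.

Lemma differentiable_mx (V : normedModType R) m n (f : V -> 'M[R]_(m, n)) x :
  (forall i j, differentiable (fun y => f y i j : R^o) x) -> differentiable f x.
Proof.
move=> df.
rewrite (_ : f = (fun y => \sum_i \sum_j f y i j *: delta_mx i j)).
  apply: differentiable_bigsum => i; apply: differentiable_bigsum => j.
  exact: differentiableZl.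
by apply/funext => y; rewrite -matrix_sum_delta.
Qed.

Lemma differentiable_entry (V : normedModType R) m n (f : V -> 'M[R]_(m, n)) x
    i j :
  differentiable f x -> differentiable (fun y => f y i j : R^o) x.
Proof.
move=> df; apply: (@differentiable_comp _ _ _ _ f (fun N => N i j : R^o)) => //.
exact: differentiable_coord.
Qed.

(** The difference of the two maps vanishes near [x], hence has differential 0. *)
Lemma near_eq_differentiable (V W : normedModType R) (f g : V -> W) (x : V) :
  {near x, f =1 g} -> differentiable f x -> differentiable g x.
Proof.
move=> fg df.
have e : g = f + (g - f) by apply/funext => y; rewrite !fctE addrC subrK.
have d0 : (g - f) \o shift x = cst ((g - f) x) + (0 : V -> W) +o_ 0 id.
  apply/eqaddoP => _/posnumP[e0].
  have fg' := nbhs_singleton fg.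
  have : \forall y \near (0 : V), f (y + x) = g (y + x).
    move: fg; rewrite (near_shift 0 x) /= subr0.
    by apply: filterS => y /=.
  apply: filterS => y /= E.
  rewrite !fctE /= E fg' !subrr [X in _ - X](_ : _ = 0) ?subr0 ?normr0.
    exact: mulr_ge0.
  exact: addr0.
have c0 : continuous (0 : V -> W) by move=> ?; exact: cst_continuous.
rewrite e; apply: differentiableD => //.
have := @diff_unique _ _ _ (g - f) (\0 : {linear V -> W}) x c0 d0.
move=> dd; apply/diff_locallyP; rewrite dd; by split.
Qed.

End Linear.

Section CkTheory.
Variable R : realType.
Implicit Types V W X : normedModType R.

Lemma CkS V W k (U : set V) (f : V -> W) : Ck k.+1 U f -> Ck k U f.
Proof.
elim: k f => [|k IH] f [df Df]; first by move=> x /df/differentiable_continuous.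
by split => // v; apply: IH.
Qed.

Lemma Ck_sub V W k (U U' : set V) (f : V -> W) :
  U' `<=` U -> Ck k U f -> Ck k U' f.
Proof.
move=> UU; elim: k f => [|k IH] f /= => [cf x /UU /cf //|[df Df]].
by split => [x /UU /df //|v]; exact: IH.
Qed.

Lemma open_near (T : topologicalType) (U : set T) x (P : T -> Prop) :
  open U -> U x -> (forall y, U y -> P y) -> \forall y \near x, P y.
Proof.
by move=> oU Ux UP; apply: filterS UP _; exact: open_nbhs_nbhs.
Qed.

Lemma Ck_ext V W k (U : set V) (f g : V -> W) :
  open U -> (forall x, U x -> f x = g x) -> Ck k U f -> Ck k U g.
Proof.
move=> oU; elim: k f g => [|k IH] f g fg /=.
  move=> cf x Ux; have := cf x Ux; rewrite /prop_for /continuous_at /=.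
  rewrite (fg x Ux).
  apply: cvg_trans; apply: near_eq_cvg.
  by apply: open_near Ux _ => // y /fg.
move=> [df Df]; split => [x Ux|v].
  by apply: near_eq_differentiable (df x Ux); exact: open_near Ux _.
apply: IH (Df v) => x Ux; apply: near_eq_derive.
by apply: open_near Ux _ => // y /fg.
Qed.

Lemma Ck_local V W k (U : set V) (f : V -> W) :
  (forall x, U x -> exists U', U' x /\ Ck k U' f) -> Ck k U f.
Proof.
elim: k f => [|k IH] f /= Uf.
  by move=> x /Uf[U' [U'x]]; exact.
split => [x /Uf[U' [U'x []]]|v]; first by move=> + _; exact.
by apply: IH => x /Uf[U' [U'x [_ /(_ v)]]]; exists U'.
Qed.

Lemma Ck_cst V W k (U : set V) (a : W) : Ck k U (cst a : V -> W).
Proof.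
elim: k a => [|k IH] a /=; first by move=> x _; exact: cst_continuous.
split => [x _|v]; first exact: differentiable_cst.
by rewrite (_ : (fun _ => _) = cst 0) //; apply/funext => x; rewrite derive_cst.
Qed.

Lemma Ck_comp_lin V W X k (U : set V) (f : V -> W) (L : {linear W -> X}) :
  open U -> continuous L -> Ck k U f -> Ck k U (fun x => L (f x)).
Proof.
move=> oU cL; elim: k f => [|k IH] f /=.
  by move=> cf x /cf cfx; apply: continuous_comp => //; exact: cL.
have dL y : differentiable L y by exact: linear_differentiable.
move=> [df Df]; split=> [x /df dfx|v]; first exact: differentiable_comp.
apply: Ck_ext oU _ (IH _ (Df v)) => x /df dfx.
rewrite !deriveE //; last exact: differentiable_comp.
by rewrite (@diff_comp _ _ _ _ f L) //= [in RHS]diff_lin.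
Qed.

Lemma CkD V W k (U : set V) (f g : V -> W) :
  open U -> Ck k U f -> Ck k U g -> Ck k U (fun x => f x + g x).
Proof.
move=> oU; elim: k f g => [|k IH] f g /=.
  by move=> cf cg x Ux; apply: continuousD; [exact: cf|exact: cg].
move=> [df Df] [dg Dg]; split=> [x Ux|v].
  by apply: differentiableD; [exact: df|exact: dg].
apply: Ck_ext oU _ (IH _ _ (Df v) (Dg v)) => x Ux.
by rewrite -deriveD //; apply: diff_derivable; [exact: df|exact: dg].
Qed.

Lemma diff_bil (U V W X : normedModType R) (B : {bilinear V -> W -> X})
    (f : U -> V) (g : U -> W) x :
  continuous (fun p => B p.1 p.2) -> differentiable f x -> differentiable g x ->
  differentiable (fun y => B (f y) (g y)) x /\
  forall v, 'D_v (fun y => B (f y) (g y)) x =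
            B (f x) ('D_v g x) + B ('D_v f x) (g x).
Proof.
move=> cB df dg.
have dp : differentiable (fun y => (f y, g y)) x by exact: differentiable_pair.
have dB p := differentiable_bilin (f := B) p cB.
have dc := @differentiable_comp _ _ _ _ (fun y => (f y, g y))
  (fun p => B p.1 p.2) x dp (dB _).
split=> // v; rewrite deriveE //.
rewrite (@diff_comp _ _ _ _ (fun y => (f y, g y)) (fun p => B p.1 p.2) x) //=.
by rewrite diff_bilin //= diff_pair //= !deriveE.
Qed.

Lemma scale_is_bilinear V :
  bilinear_for
    (GRing.Scale.Law.clone _ _ *:%R _) (GRing.Scale.Law.clone _ _ *:%R _)
    (@GRing.scale R V : R^o -> V -> V).
Proof.
split=> [u'|u] a x y /=; first by rewrite scalerDl scalerA.
by rewrite scalerDr !scalerA mulrC.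
Qed.
HB.instance Definition _ V := bilinear_isBilinear.Build R R^o V V _ _
  (@GRing.scale R V) (scale_is_bilinear V).

Lemma CkZ V W k (U : set V) (a : V -> R^o) (f : V -> W) :
  open U -> Ck k U a -> Ck k U f -> Ck k U (fun x => a x *: f x).
Proof.
move=> oU; elim: k a f => [|k IH] a f /=.
  by move=> ca cf x Ux; apply: continuousZ; [exact: ca|exact: cf].
move=> [da Da] [df Df].
have dZ x Ux := @diff_bil _ _ _ _ (@GRing.scale R W : R^o -> W -> W) a f x
  (@scale_continuous _ _) (da x Ux) (df x Ux).
split=> [x /dZ[]//|v].
have Ca : Ck k U a by exact: CkS (conj da Da).
have Cf : Ck k U f by exact: CkS (conj df Df).
apply: Ck_ext oU _ (CkD oU (IH _ _ Ca (Df v)) (IH _ _ (Da v) Cf)) => x Ux /=.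
by have [_ ->] := dZ x Ux.
Qed.

Lemma Ck_sum V W k (U : set V) (I : Type) (r : seq I) (f : I -> V -> W) :
  open U -> (forall i, Ck k U (f i)) -> Ck k U (fun x => \sum_(i <- r) f i x).
Proof.
move=> oU Cf; elim: r => [|i r IH].
  rewrite (_ : (fun _ => _) = cst 0); first exact: Ck_cst.
  by apply/funext => y; rewrite big_nil.
rewrite (_ : (fun _ => _) = (fun y => f i y + \sum_(j <- r) f j y)).
  exact: CkD.
by apply/funext => y; rewrite big_cons.
Qed.

Definition mx_entry m n (i : 'I_m) (j : 'I_n) (M : 'M[R]_(m, n)) : R^o := M i j.

Fact mx_entry_is_linear m n i j : linear (@mx_entry m n i j).
Proof. by move=> a M N; rewrite /mx_entry !mxE. Qed.
HB.instance Definition _ m n i j := GRing.isLinear.Build R 'M[R]_(m, n) R^o _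
  (@mx_entry m n i j) (@mx_entry_is_linear m n i j).

(** Chain rule in coordinates: it expresses the derivative of a composite as a
sum of products, which is what the induction in [smooth_comp] needs. *)
Lemma deriv_comp_sum V W d (f : V -> 'cV[R]_d) (g : 'cV[R]_d -> W) x v :
  differentiable f x -> differentiable g (f x) ->
  'D_v (g \o f) x =
    \sum_i (('D_v f x) i 0 : R^o) *: 'D_(ebasis R i) g (f x).
Proof.
move=> df dg; rewrite deriveE; last exact: differentiable_comp.
rewrite diff_comp //= matrix_delta_sum deriveE //.
by apply: eq_bigr => i _; rewrite big_ord1 deriveE.
Qed.

(** Induction on the order: by the chain rule a derivative of [g \o f] is a sum of
products of derivatives of [f] with composites of derivatives of [g]. *)
Lemma smooth_comp V W d (U : set V) (U' : set 'cV[R]_d)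
    (f : V -> 'cV[R]_d) (g : 'cV[R]_d -> W) :
  open U -> (forall x, U x -> U' (f x)) ->
  smooth_on U f -> smooth_on U' g -> smooth_on U (g \o f).
Proof.
move=> oU UU sf sg k; move: {sf sg}(sf k) (sg k); elim: k g => [|k IH] g.
  move=> /= cf cg x Ux; apply: continuous_comp; first exact: cf.
  by apply: cg; exact: UU.
move=> Cf [dg Dg]; have [df Df] := Cf; split=> [x Ux|v].
  by apply: differentiable_comp; [exact: df|apply/dg/UU].
have := @Ck_sum V W k U _ (index_enum 'I_d) (fun i x =>
  (('D_v f x) i 0 : R^o) *: ('D_(ebasis R i) g \o f) x) oU.
move=> H; apply: (Ck_ext oU _ (H _)) => {H} [x Ux|i].
  by rewrite (deriv_comp_sum v (df x Ux) (dg _ (UU _ Ux))).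
apply: CkZ => //; last exact: IH (CkS Cf) (Dg _).
pose L := @mx_entry d 1 i 0 : {linear _ -> R^o}.
exact: (Ck_comp_lin (L := L) oU (@linear_mx_continuous _ _ _ _ L) (Df v)).
Qed.

Lemma smooth_lin (W : normedModType R) m n (U : set 'M[R]_(m, n))
    (L : {linear 'M[R]_(m, n) -> W}) : smooth_on U L.
Proof.
case=> [|k] /=; first by move=> x _; exact: linear_mx_continuous.
split=> [x _|v]; first exact: linear_mx_differentiable.
rewrite (_ : (fun _ => _) = cst (L v)); first exact: Ck_cst.
apply/funext => x; rewrite deriveE; last exact: linear_mx_differentiable.
by rewrite diff_lin //; exact: linear_mx_continuous.
Qed.

Lemma smooth_comp_lin V (X : normedModType R) m n (U : set V)
    (f : V -> 'M[R]_(m, n)) (L : {linear 'M[R]_(m, n) -> X}) :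
  open U -> smooth_on U f -> smooth_on U (fun x => L (f x)).
Proof.
by move=> oU sf k; apply: Ck_comp_lin => //; exact: linear_mx_continuous.
Qed.

Lemma smooth_cst V W (U : set V) (a : W) : smooth_on U (cst a : V -> W).
Proof. by move=> k; exact: Ck_cst. Qed.

Lemma smoothD V W (U : set V) (f g : V -> W) :
  open U -> smooth_on U f -> smooth_on U g -> smooth_on U (fun x => f x + g x).
Proof. by move=> oU sf sg k; exact: CkD. Qed.

Lemma smooth_sub V W (U U' : set V) (f : V -> W) :
  U' `<=` U -> smooth_on U f -> smooth_on U' f.
Proof. by move=> UU sf k; exact: Ck_sub (sf k). Qed.

Lemma smooth_ext V W (U : set V) (f g : V -> W) :
  open U -> (forall x, U x -> f x = g x) -> smooth_on U f -> smooth_on U g.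
Proof. by move=> oU fg sf k; exact: Ck_ext (sf k). Qed.

Lemma smooth_local V W (U : set V) (f : V -> W) :
  (forall x, U x -> exists U', U' x /\ smooth_on U' f) -> smooth_on U f.
Proof.
by move=> Uf k; apply: Ck_local => x /Uf[U' [? s]]; exists U'.
Qed.

Lemma smooth_differentiable V W (U : set V) (f : V -> W) x :
  smooth_on U f -> U x -> differentiable f x.
Proof. by move=> /(_ 1)[+ _]; exact. Qed.

Lemma smooth_derive V W (U : set V) (f : V -> W) v :
  smooth_on U f -> smooth_on U ('D_v f).
Proof. by move=> sf k; have [_] := sf k.+1; exact. Qed.

Lemma smooth_continuous V W (U : set V) (f : V -> W) x :
  smooth_on U f -> U x -> {for x, continuous f}.
Proof. by move=> /(_ 0); exact. Qed.

Lemma open_preim_in (V : topologicalType) (W : topologicalType)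
    (U : set V) (f : V -> W) (S : set W) :
  open U -> (forall x, U x -> {for x, continuous f}) -> open S ->
  open (U `&` f @^-1` S).
Proof.
move=> oU cf oS; rewrite openE => x [Ux Sx].
apply: filterI; first exact: open_nbhs_nbhs.
by apply: (cf x Ux); exact: open_nbhs_nbhs.
Qed.

End CkTheory.

(** * Jacobian matrices *)

Section Jac.
Variable R : realType.

Lemma jacE d e (f : 'cV[R]_d -> 'cV[R]_e) x v :
  differentiable f x -> jac f x *m v = 'D_v f x.
Proof.
move=> df; rewrite deriveE // [v in RHS]matrix_sum_delta.
apply/colP => i; rewrite /jac mxE linear_sum summxE; apply: eq_bigr => j _.
by rewrite mxE big_ord1 linearZ mxE mulrC.
Qed.

Lemma mulmx_cV_inj m n (A B : 'M[R]_(m, n)) :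
  (forall v : 'cV[R]_n, A *m v = B *m v) -> A = B.
Proof.
move=> AB; apply/matrixP => i j; have := AB (delta_mx j 0).
by rewrite -!colE => /colP/(_ i); rewrite !mxE.
Qed.

Lemma jac_comp d e e' (f : 'cV[R]_d -> 'cV[R]_e) (g : 'cV[R]_e -> 'cV[R]_e') x :
  differentiable f x -> differentiable g (f x) ->
  jac (g \o f) x = jac g (f x) *m jac f x.
Proof.
move=> df dg; have dgf := differentiable_comp df dg.
apply: mulmx_cV_inj => v; rewrite -mulmxA (jacE v df) (jacE _ dg) (jacE v dgf).
rewrite (deriveE _ df) (deriveE _ dg) (deriveE _ dgf).
by rewrite (diff_comp df dg).
Qed.

Lemma jac_ext d e (f g : 'cV[R]_d -> 'cV[R]_e) x :
  {near x, f =1 g} -> differentiable f x -> jac f x = jac g x.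
Proof.
move=> fg df; have dg := near_eq_differentiable fg df.
apply: mulmx_cV_inj => v.
apply: etrans (jacE v df) _.
apply: etrans _ (esym (jacE v dg)).
exact: near_eq_derive.
Qed.

Lemma jac_lin d e (L : {linear 'cV[R]_d -> 'cV[R]_e}) x v : jac L x *m v = L v.
Proof.
have dL := linear_mx_differentiable L x.
rewrite (jacE v dL) (deriveE _ dL) diff_lin //.
exact: linear_mx_continuous.
Qed.

Lemma jac_id d (x : 'cV[R]_d) : jac idfun x = 1%:M.
Proof. by apply: mulmx_cV_inj => v; rewrite (jac_lin idfun) mul1mx. Qed.

End Jac.

(** * Symmetry of second derivatives *)

Section Schwarz.
Variables (R : realType) (V : normedModType R).
Implicit Types (f : V -> R^o) (a b v w : V).

(** Both difference quotients are the same function of [h]. *)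
Lemma line_derive (W : normedModType R) (f : V -> W) b v (s : R) :
  differentiable f (b + s *: v) ->
  is_derive s 1 (fun r : R => f (b + r *: v)) ('D_v f (b + s *: v)).
Proof.
move=> df; have E : (fun h : R => h^-1 *:
      (((fun r : R => f (b + r *: v)) \o shift s) (h *: (1 : R^o)) -
       f (b + s *: v))) =
    (fun h => h^-1 *: ((f \o shift (b + s *: v)) (h *: v) - f (b + s *: v))).
  by apply/funext => h /=; rewrite [h *: 1]mulr1 scalerDl addrCA addrA.
split; last by rewrite /derive E.
by rewrite /derivable E; exact: diff_derivable df.
Qed.

Lemma shift_derive (W : normedModType R) (f : V -> W) b x v :
  differentiable f (x + b) ->
  is_derive x v (fun y => f (y + b)) ('D_v f (x + b)).
Proof.
move=> df; have E : (fun h : R => h^-1 *: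
      (((fun y => f (y + b)) \o shift x) (h *: v) - f (x + b))) =
    (fun h => h^-1 *: ((f \o shift (x + b)) (h *: v) - f (x + b))).
  by apply/funext => h /=; rewrite addrA.
split; last by rewrite /derive E.
by rewrite /derivable E; exact: diff_derivable df.
Qed.

Lemma line_MVT f b v (t : R) : 0 <= t ->
  (forall s, 0 <= s <= t -> differentiable f (b + s *: v)) ->
  exists2 s, 0 <= s <= t & f (b + t *: v) - f b = 'D_v f (b + s *: v) * t.
Proof.
move=> t0 df.
have [||s sI E] := @MVT_segment R (fun r => f (b + r *: v))
   (fun s => 'D_v f (b + s *: v)) 0 t t0.
- move=> s; rewrite in_itv /= => /andP[s0 st].
  by apply: line_derive; apply: df; rewrite !ltW.
- apply: derivable_within_continuous => s; rewrite in_itv /= => st.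
  by have [] := line_derive (df s st).
exists s; first by move: sI; rewrite in_itv.
by move: E; rewrite scale0r addr0 subr0.
Qed.

(** Two applications of the mean value theorem, first to the increment
[f (x + t *: w) - f x] along [v], then to ['D_v f] along [w]. *)
Lemma second_difference f a v w (t : R) (U : set V) : 0 <= t ->
  (forall r s, 0 <= r <= t -> 0 <= s <= t -> U (a + r *: v + s *: w)) ->
  Ck 2 U f ->
  exists r s, [/\ 0 <= r <= t, 0 <= s <= t &
   f (a + t *: v + t *: w) - f (a + t *: v) - (f (a + t *: w) - f a) =
   'D_w ('D_v f) (a + r *: v + s *: w) * t * t].
Proof.
move=> t0 UU [df /(_ v)[ddf _]].
have tt : 0 <= t <= t by rewrite t0 lexx.
have z0 : 0 <= (0 : R) <= t by rewrite t0 lexx.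
pose g x := f (x + t *: w) - f x.
have U1 r : 0 <= r <= t -> U (a + r *: v).
  by move=> /UU/(_ z0); rewrite scale0r addr0.
have dsh x : differentiable f (x + t *: w) ->
    differentiable (fun y => f (y + t *: w)) x.
  move=> d; apply: (@differentiable_comp _ _ _ _ (fun y => y + t *: w) f x _ d).
  have := @differentiableD _ _ _ _ (cst (t *: w)) x
    (@ex_diff _ _ _ _ _ _ _ (is_diff_id x)) (differentiable_cst _ _).
  exact.
have [|r rt E] := @line_MVT g a v t t0.
  move=> s st; apply: (@differentiableB _ _ _ (fun y => f (y + t *: w)) f).
    by apply: dsh; apply: df; exact: UU.
  exact/df/U1.
have [|s st E2] := @line_MVT ('D_v f) (a + r *: v) w t t0.
  by move=> s st; apply: ddf; exact: UU.
exists r, s; split => //.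
rewrite -/(g (a + t *: v)) -/(g a) E; congr (_ * t); rewrite -E2.
have Hr := df _ (U1 _ rt); have Hr' := df _ (UU _ _ rt tt).
have [D1 D2] := shift_derive v Hr'.
have := deriveB D1 (@diff_derivable _ _ _ _ _ v Hr); rewrite D2 => <-.
by [].
Qed.

Lemma near_square (a v w : V) (U : set V) : nbhs a U ->
  exists2 t : R, 0 < t &
   forall r s, 0 <= r <= t -> 0 <= s <= t -> U (a + r *: v + s *: w).
Proof.
move=> /nbhs_ballP[e /= e0 eU]; pose m := `|v| + `|w| + 1.
have m0 : 0 < m by rewrite ltr_wpDl // addr_ge0.
exists (e / m); first by rewrite divr_gt0.
move=> r s /andP[r0 rt] /andP[s0 st]; apply: eU.
rewrite -ball_normE /= -addrA opprD addrA subrr add0r normrN.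
apply: (le_lt_trans (ler_normD _ _)); rewrite !normrZ !ger0_norm //.
apply: (@le_lt_trans _ _ (e / m * `|v| + e / m * `|w|)).
  by apply: lerD; apply: ler_wpM2r.
rewrite -mulrDr -mulrA gtr_pMr // ltr_pdivrMl // mulr1 /m ltrDl //.
Qed.

(** The second difference of [f] is symmetric in [v] and [w]; by
[second_difference] it is, up to the factor [t * t], a value of either mixed
derivative near [a], and both are continuous. *)
Lemma schwarz f a v w (U : set V) : open U -> U a -> Ck 2 U f ->
  'D_v ('D_w f) a = 'D_w ('D_v f) a.
Proof.
move=> oU Ua Cf; apply/eqP; rewrite -subr_eq0 -normr_le0.
apply/ler_addgt0Pr => e e0; rewrite add0r.
have [_ Df] := Cf.
have cP : {for a, continuous ('D_w ('D_v f))} by exact: (proj2 (Df v) w a Ua).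
have cQ : {for a, continuous ('D_v ('D_w f))} by exact: (proj2 (Df w) v a Ua).
have e2 : 0 < e / 2 by rewrite divr_gt0.
have /cvgrPdist_lt/(_ _ e2) nP := cP; have /cvgrPdist_lt/(_ _ e2) nQ := cQ.
have nU : nbhs a U by exact: open_nbhs_nbhs.
have [t t0 H] := near_square v w (filterI nU (filterI nP nQ)).
have HU r s (rt : 0 <= r <= t) (st : 0 <= s <= t) := (H r s rt st).1.
have [r [s [rt st E]]] := second_difference (ltW t0) HU Cf.
have HU' r' s' (rt' : 0 <= r' <= t) (st' : 0 <= s' <= t) :
    U (a + r' *: w + s' *: v) by rewrite addrAC; exact: HU.
have [r' [s' [rt' st' E']]] := second_difference (ltW t0) HU' Cf.
have {E E'} : 'D_w ('D_v f) (a + r *: v + s *: w) =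
     'D_v ('D_w f) (a + r' *: w + s' *: v).
  have abel (x y z u : R) : x - y - (z - u) = x - z - (y - u).
    by rewrite !opprB addrACA [RHS]addrACA [- y - z]addrC.
  have tn : t != 0 by rewrite gt_eqF.
  apply: (mulIf tn (mulIf tn _)); apply: etrans (esym E) (etrans _ E').
  rewrite [a + t *: w + _]addrAC; exact: abel.
rewrite [a + r' *: w + _]addrAC => E.
have [_ [P1 _]] := H _ _ rt st; have [_ [_ Q1]] := H _ _ st' rt'.
rewrite (splitr e) -(subrKA ('D_v ('D_w f) (a + s' *: v + r' *: w))).
apply: (le_trans (ler_normD _ _)); apply: lerD; first exact: (ltW Q1).
by rewrite -E distrC; exact: (ltW P1).
Qed.

End Schwarz.

(** * Smooth maps read in charts *)

Section Charts.
Variable R : realType.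

Definition covering d T (A : atlas R d T) :=
  forall x, charts A (chart_at A x) /\ cdom (chart_at A x) x.

Definition chart_inverse d T (A : atlas R d T) :=
  forall c, charts A c -> forall x, cdom c x -> cinv c (cmap c x) = x.

(** What remains of a smooth manifold when the topology of [T] is forgotten.
All the calculus below takes place in charts, and regular atlases, unlike
topological manifolds, are visibly stable under products. *)
Definition regular d T (A : atlas R d T) :=
  [/\ covering A, chart_inverse A & smooth_map A A setT id].

(** Openness of a set, tested in charts only. *)
Definition chart_open d T (A : atlas R d T) (S : set T) :=
  forall c, charts A c -> open (cmap c @` (S `&` cdom c)).

Definition in_charts d e S T (c : chart R d S) (c' : chart R e T) (f : S -> T) :=
  cmap c' \o f \o cinv c.

Section OneAtlas.
Variables (d : nat) (T : Type) (A : atlas R d T).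
Hypothesis rA : regular A.
Let cA : covering A. Proof. by case: rA. Qed.
Let iA : chart_inverse A. Proof. by case: rA. Qed.

Lemma chart_openI S S' : chart_open A S -> chart_open A S' ->
  chart_open A (S `&` S').
Proof.
move=> oS oS' c cc.
rewrite (_ : _ @` _ = (cmap c @` (S `&` cdom c)) `&` (cmap c @` (S' `&` cdom c))).
  exact: openI (oS c cc) (oS' c cc).
apply/seteqP; split=> [y [x [[Sx S'x] cx] <-]|y [[x [Sx cx] <-] [x' [Sx' cx'] E]]].
  by split; exists x.
exists x => //; split => //; split => //.
by rewrite -(iA cc cx) -E (iA cc cx').
Qed.

Lemma chart_openT : chart_open A setT.
Proof.
move=> c cc; rewrite openE => y [x [_ cx] <-].
have [_ cx'] := cA x; have [cc' _] := cA x.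
have [_ _ /(_ c (chart_at A x) cc cc')[oU _]] := rA.
apply: filterS (open_nbhs_nbhs (conj oU _)); last by exists x.
by move=> _ [z [[_ cz] _] <-]; exists z.
Qed.

Lemma chart_open_cdom c : charts A c -> chart_open A (cdom c).
Proof.
move=> cc c' cc'; have [_ _ /(_ c' c cc' cc)[+ _]] := rA.
congr open; congr image; apply/seteqP; split=> x.
  by move=> [[_ ?] ?].
by move=> [? ?].
Qed.

End OneAtlas.

Section TwoAtlases.
Variables (d e : nat) (S T : Type) (A : atlas R d S) (B : atlas R e T).
Hypothesis rA : regular A.
Let cA : covering A. Proof. by case: rA. Qed.
Let iA : chart_inverse A. Proof. by case: rA. Qed.
Implicit Types (f g : S -> T) (W : set S).

Lemma smooth_map_ext W f g : (forall x, W x -> f x = g x) ->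
  smooth_map A B W f -> smooth_map A B W g.
Proof.
move=> fg sf c c' cc cc'; have [oU sU] := sf c c' cc cc'.
rewrite (_ : W `&` cdom c `&` g @^-1` cdom c' =
             W `&` cdom c `&` f @^-1` cdom c'); last first.
  by apply/seteqP; split=> x [[Wx cx]]; rewrite /preimage /= (fg _ Wx).
split=> //; apply: smooth_ext sU => // _ [x [[Wx cx] _] <-] /=.
by rewrite (iA cc cx) fg.
Qed.

Lemma smooth_map_sub W W' f : W' `<=` W -> chart_open A W' ->
  smooth_map A B W f -> smooth_map A B W' f.
Proof.
move=> WW oW sf c c' cc cc'; have [oU sU] := sf c c' cc cc'.
have E : cmap c @` (W' `&` cdom c `&` f @^-1` cdom c') =
    (cmap c @` (W `&` cdom c `&` f @^-1` cdom c')) `&`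
    (cmap c @` (W' `&` cdom c)).
  apply/seteqP; split.
    move=> _ [x [[Wx cx] fx] <-]; split.
      by exists x => //; split=> //; split => //; exact: WW.
    by exists x.
  move=> _ [[x [[Wx cx] fx] <-] [x' [Wx' cx'] E]].
  exists x => //; split => //; split => //.
  by rewrite -(iA cc cx) -E (iA cc cx').
rewrite E; split; first exact: openI oU (oW c cc).
by apply: smooth_sub sU => y [].
Qed.

Lemma smooth_map_loc W f x c c' : smooth_map A B W f -> W x ->
  charts A c -> charts B c' -> cdom c x -> cdom c' (f x) ->
  differentiable (in_charts c c' f) (cmap c x).
Proof.
move=> sf Wx cc cc' cx cfx; have [oU sU] := sf c c' cc cc'.
by apply: smooth_differentiable sU _; exists x.
Qed.

Lemma mdiff_diff W f x : covering B -> smooth_map A B W f -> W x ->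
  differentiable (in_charts (chart_at A x) (chart_at B (f x)) f)
                 (cmap (chart_at A x) x).
Proof.
move=> cB sf Wx; have [? ?] := cA x; have [? ?] := cB (f x).
exact: smooth_map_loc sf Wx _ _ _ _.
Qed.

Lemma mdiffE f x :
  mdiff A B f x = jac (in_charts (chart_at A x) (chart_at B (f x)) f)
                      (cmap (chart_at A x) x).
Proof. by []. Qed.

Lemma jac_charts_ext W f g x (c : chart R d S) (c' : chart R e T) :
  chart_open A W -> W x -> charts A c -> cdom c x -> (forall y, W y -> f y = g y) ->
  differentiable (in_charts c c' f) (cmap c x) ->
  jac (in_charts c c' f) (cmap c x) = jac (in_charts c c' g) (cmap c x).
Proof.
move=> oW Wx cc cx fg df; apply: jac_ext df.
apply: (open_near (oW c cc)); first by exists x.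
by move=> _ [y [Wy cy] <-]; rewrite /in_charts /= (iA cc cy) fg.
Qed.

Lemma mdiff_ext W f g x : covering B -> chart_open A W -> W x ->
  (forall y, W y -> f y = g y) -> smooth_map A B W f ->
  mdiff A B f x = mdiff A B g x.
Proof.
move=> cB oW Wx fg sf; have [? ?] := cA x.
rewrite !mdiffE -(fg x Wx); apply: (jac_charts_ext oW) => //.
exact: mdiff_diff sf Wx.
Qed.

Lemma smooth_map_chart_open W f O : regular B ->
  smooth_map A B W f -> chart_open B O -> chart_open A (W `&` f @^-1` O).
Proof.
move=> [cB iB _] sf oO c cc; rewrite openE => _ [x [[Wx Ox] cx] <-].
have [cc' cfx] := cB (f x); have [oU sU] := sf c _ cc cc'.
set U := (X in open X) in oU sU.
have oV : open (U `&` (in_charts c (chart_at B (f x)) f) @^-1`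
     (cmap (chart_at B (f x)) @` (O `&` cdom (chart_at B (f x))))).
  exact: (open_preim_in oU (fun y Uy => smooth_continuous sU Uy) (oO _ cc')).
apply: filterS (open_nbhs_nbhs (conj oV _)).
  move=> _ [[y [[Wy cy] fy] <-] [z [Oz cz]]].
  rewrite /in_charts /= (iA cc cy) => E.
  exists y => //; split => //; split => //=.
  by rewrite /preimage /= -(iB _ cc' _ fy) -E (iB _ cc' _ cz).
split; first by exists x.
by exists (f x) => //; rewrite /in_charts /= (iA cc cx).
Qed.

Lemma smooth_map_open W f : regular B -> smooth_map A B W f -> chart_open A W.
Proof.
move=> rB sf; have := smooth_map_chart_open rB sf (chart_openT rB).
by rewrite preimage_setT setIT.
Qed.

End TwoAtlases.

Section ThreeAtlases.
Variables (d e l : nat) (S T Q : Type).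
Variables (A : atlas R d S) (B : atlas R e T) (C : atlas R l Q).
Hypotheses (rA : regular A) (rB : regular B).
Let cA : covering A. Proof. by case: rA. Qed.
Let iA : chart_inverse A. Proof. by case: rA. Qed.
Let cB : covering B. Proof. by case: rB. Qed.
Let iB : chart_inverse B. Proof. by case: rB. Qed.
Variables (f : S -> T) (g : T -> Q) (W : set S) (W' : set T).
Hypotheses (sf : smooth_map A B W f) (sg : smooth_map B C W' g).

(** Near a point the composite factors through a chart of [T]. *)
Lemma smooth_map_comp : (forall x, W x -> W' (f x)) ->
  smooth_map A C W (g \o f).
Proof.
move=> WW c c' cc cc'.
have oO : chart_open B (W' `&` g @^-1` cdom c').
  move=> c1 cc1; have [+ _] := sg cc1 cc'; congr open; congr image.
  by rewrite setIAC.
have oU : open (cmap c @` (W `&` cdom c `&` (g \o f) @^-1` cdom c')).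
  have := smooth_map_chart_open rA rB sf oO cc; congr open; congr image.
  apply/seteqP; split=> x.
    by move=> [[Wx [_ ?]] ?].
  by move=> [[Wx ?] ?]; split => //; split => //; split => //; exact: WW.
split => //; apply: smooth_local => _ [x [[Wx cx] gx] <-].
have [cc1 fx] := cB (f x); set c1 := chart_at B (f x) in cc1 fx.
have [oV sV] := sf cc cc1; set V := (X in open X) in oV sV.
have [oV' sV'] := sg cc1 cc'; set V' := (X in open X) in oV' sV'.
pose V1 := V `&` (in_charts c c1 f) @^-1` V'.
have oV1 : open V1.
  exact: (open_preim_in oV (fun y Vy => smooth_continuous sV Vy) oV').
exists V1; split.
  split; first by exists x.
  exists (f x); last by rewrite /in_charts /= (iA cc cx).
  by split => //; split => //; exact: WW.
apply: (@smooth_ext R _ _ V1 (in_charts c1 c' g \o in_charts c c1 f)) => //.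
  move=> _ [[y [[Wy cy] fy] <-] _]; rewrite /in_charts /= (iA cc cy).
  by rewrite (iB cc1 fy).
apply: (@smooth_comp R _ _ _ V1 V') => //; first by move=> y [].
by apply: smooth_sub sV => y [].
Qed.

Lemma jac_charts_comp x c c1 c' : W x -> W' (f x) ->
  charts A c -> charts B c1 -> charts C c' ->
  cdom c x -> cdom c1 (f x) -> cdom c' (g (f x)) ->
  jac (in_charts c c' (g \o f)) (cmap c x) =
  jac (in_charts c1 c' g) (cmap c1 (f x)) *m jac (in_charts c c1 f) (cmap c x).
Proof.
move=> Wx Wfx cc cc1 cc' cx fx gx.
have df := smooth_map_loc sf Wx cc cc1 cx fx.
have dg := smooth_map_loc sg Wfx cc1 cc' fx gx.
have E : in_charts c c1 f (cmap c x) = cmap c1 (f x).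
  by rewrite /in_charts /= (iA cc cx).
rewrite -[in RHS]E; rewrite -[in X in differentiable _ X]E in dg.
have dgf := differentiable_comp df dg.
apply: etrans _ (jac_comp df dg); apply: esym; apply: (jac_ext _ dgf).
have [oU _] := sf cc cc1; apply: (open_near oU); first by exists x.
move=> _ [y [[Wy cy] fy] <-]; rewrite /in_charts /= (iA cc cy).
by rewrite (iB cc1 fy).
Qed.

Lemma mdiff_comp x : covering C -> W x -> W' (f x) ->
  mdiff A C (g \o f) x = mdiff B C g (f x) *m mdiff A B f x.
Proof.
move=> cC Wx Wfx; have [? ?] := cA x; have [? ?] := cB (f x).
have [? ?] := cC (g (f x)).
by rewrite !mdiffE; apply: jac_charts_comp.
Qed.

End ThreeAtlases.

Section Transitions.
Variables (d : nat) (T : Type) (A : atlas R d T).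
Hypothesis rA : regular A.
Let cA : covering A. Proof. by case: rA. Qed.
Let iA : chart_inverse A. Proof. by case: rA. Qed.
Let sid : smooth_map A A setT id. Proof. by case: rA. Qed.

Lemma transition_comp c c1 c' x : charts A c -> charts A c1 -> charts A c' ->
  cdom c x -> cdom c1 x -> cdom c' x ->
  transition c1 c' x *m transition c c1 x = transition c c' x.
Proof.
move=> cc cc1 cc' cx cx1 cx'.
exact/esym/(@jac_charts_comp _ _ _ _ _ _ A A A rA rA id id setT setT sid sid x c c1 c').
Qed.

Lemma transition_refl c x : charts A c -> cdom c x -> transition c c x = 1%:M.
Proof.
move=> cc cx; rewrite -(jac_id (cmap c x)); apply/esym/jac_ext; last first.
  exact: (linear_mx_differentiable idfun).
apply: (open_near (chart_openT rA cc)); first by exists x.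
by move=> _ [y [_ cy] <-] /=; rewrite (iA cc cy).
Qed.

Lemma transition_unit c c' x : charts A c -> charts A c' -> cdom c x ->
  cdom c' x -> transition c c' x \in unitmx.
Proof.
move=> cc cc' cx cx'; have := transition_comp cc cc' cc cx cx' cx.
by rewrite (transition_refl cc cx) => /mulmx1_unit[].
Qed.

Lemma mdiff_id x : mdiff A A id x = 1%:M.
Proof. by have [cc cx] := cA x; exact: transition_refl. Qed.

End Transitions.

Section TwoAtlases2.
Variables (d e : nat) (S T : Type) (A : atlas R d S) (B : atlas R e T).
Hypotheses (rA : regular A) (rB : regular B).
Let cA : covering A. Proof. by case: rA. Qed.
Let cB : covering B. Proof. by case: rB. Qed.

(** Change of charts for the Jacobian: [mdiff] uses the preferred charts, which
jump with the point, whereas differentiating twice requires fixed charts. *)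
Lemma jac_charts W (f : S -> T) x c c' : smooth_map A B W f -> W x ->
  charts A c -> charts B c' -> cdom c x -> cdom c' (f x) ->
  transition c' (chart_at B (f x)) (f x) *m jac (in_charts c c' f) (cmap c x) =
  mdiff A B f x *m transition c (chart_at A x) x.
Proof.
move=> sf Wx cc cc' cx cfx; have [ca xa] := cA x; have [cb xb] := cB (f x).
have [_ _ sA] := rA; have [_ _ sB] := rB.
have E1 := @jac_charts_comp _ _ _ _ _ _ A B B rA rB f id W setT sf sB x c c'
  (chart_at B (f x)) Wx I cc cc' cb cx cfx xb.
have E2 := @jac_charts_comp _ _ _ _ _ _ A A B rA rA id f setT W sA sf x c
  (chart_at A x) (chart_at B (f x)) I Wx cc ca cb cx xa xb.
exact: etrans (esym E1) E2.
Qed.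

End TwoAtlases2.
End Charts.

(** * Euclidean spaces, topological manifolds and products *)

Section Blocks.
Variable R : realType.

Lemma col_mx_split (V : Type) m n (f : V -> 'cV[R]_m) (g : V -> 'cV[R]_n) :
  (fun y => col_mx (f y) (g y)) =
  (fun y => col_mx 1%:M 0 *m f y + col_mx 0 1%:M *m g y).
Proof.
apply/funext => y.
by rewrite !mul_col_mx !mul1mx !mul0mx add_col_mx addr0 add0r.
Qed.

Lemma smooth_col_mx (V : normedModType R) m n (U : set V)
    (f : V -> 'cV[R]_m) (g : V -> 'cV[R]_n) : open U ->
  smooth_on U f -> smooth_on U g ->
  smooth_on U (fun y => col_mx (f y) (g y)).
Proof.
move=> oU sf sg; rewrite col_mx_split; apply: (smoothD oU).
  exact: (smooth_comp_lin (mulmx (col_mx 1%:M 0)) oU sf).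
exact: (smooth_comp_lin (mulmx (col_mx 0 1%:M)) oU sg).
Qed.

Lemma differentiable_col_mx (V : normedModType R) m n
    (f : V -> 'cV[R]_m) (g : V -> 'cV[R]_n) x :
  differentiable f x -> differentiable g x ->
  differentiable (fun y => col_mx (f y) (g y)) x.
Proof.
move=> df dg; rewrite col_mx_split.
apply: (@differentiableD _ _ _ (fun y => col_mx 1%:M 0 *m f y)
  (fun y => col_mx 0 1%:M *m g y)).
  apply: (@differentiable_comp _ _ _ _ f (mulmx (col_mx 1%:M 0)) x df).
  exact: (linear_mx_differentiable (mulmx (col_mx 1%:M 0))).
apply: (@differentiable_comp _ _ _ _ g (mulmx (col_mx 0 1%:M)) x dg).
exact: (linear_mx_differentiable (mulmx (col_mx 0 1%:M))).
Qed.

Lemma jac_lin_comp d e l (f : 'cV[R]_d -> 'cV[R]_e)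
    (L : {linear 'cV[R]_e -> 'cV[R]_l}) x (v : 'cV[R]_d) : differentiable f x ->
  jac (fun y => L (f y)) x *m v = L (jac f x *m v).
Proof.
move=> df; have dL := linear_mx_differentiable L (f x).
apply: etrans (congr1 (mulmx^~ v) (jac_comp df dL)) _.
by rewrite -mulmxA jac_lin.
Qed.

Lemma jac_comp_lin d e l (f : 'cV[R]_e -> 'cV[R]_l)
    (L : {linear 'cV[R]_d -> 'cV[R]_e}) x (v : 'cV[R]_d) : differentiable f (L x) ->
  jac (fun y => f (L y)) x *m v = jac f (L x) *m L v.
Proof.
move=> df; have dL := linear_mx_differentiable L x.
apply: etrans (congr1 (mulmx^~ v) (jac_comp dL df)) _.
by rewrite -mulmxA jac_lin.
Qed.

Lemma jac_col_mx d m n (f : 'cV[R]_d -> 'cV[R]_m) (g : 'cV[R]_d -> 'cV[R]_n) x (v : 'cV[R]_d) :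
  differentiable f x -> differentiable g x ->
  jac (fun y => col_mx (f y) (g y)) x *m v = col_mx (jac f x *m v) (jac g x *m v).
Proof.
move=> df dg; have dfg := differentiable_col_mx df dg.
rewrite -[LHS]vsubmxK; congr col_mx.
  apply: etrans (esym (jac_lin_comp usubmx v dfg)) _.
  apply: (congr1 (fun h => jac h x *m v)).
  by apply/funext => y; rewrite /= col_mxKu.
apply: etrans (esym (jac_lin_comp dsubmx v dfg)) _.
apply: (congr1 (fun h => jac h x *m v)).
by apply/funext => y; rewrite /= col_mxKd.
Qed.

Lemma open_lin_preim m n m' n' (L : {linear 'M[R]_(m, n) -> 'M[R]_(m', n')})
  (U : set 'M[R]_(m', n')) : open U -> open (L @^-1` U).
Proof.
by move=> oU; apply: open_comp => // x _; exact: linear_mx_continuous.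
Qed.

End Blocks.

Section Euclid.
Variable R : realType.

Lemma image_idfun (T : Type) (S : set T) : idfun @` S = S.
Proof. by rewrite image_id. Qed.

Lemma smooth_map_euclid d e (U : set 'cV[R]_d) (f : 'cV[R]_d -> 'cV[R]_e) :
  open U -> smooth_on U f -> smooth_map (euclid R d) (euclid R e) U f.
Proof.
move=> oU sf c c' -> -> /=; rewrite image_idfun.
by rewrite (_ : _ `&` _ = U) //; apply/seteqP; split=> [x [[]]|x].
Qed.

Lemma regular_euclid d : regular (euclid R d).
Proof.
split=> [x|c -> //|]; first by split.
by apply: smooth_map_euclid; [exact: openT|exact: (smooth_lin setT idfun)].
Qed.

End Euclid.

Section ChartMaps.
Variables (R : realType) (d : nat) (T : Type) (A : atlas R d T).
Hypothesis rA : regular A.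
Let cA : covering A. Proof. by case: rA. Qed.
Let iA : chart_inverse A. Proof. by case: rA. Qed.
Let sid : smooth_map A A setT id. Proof. by case: rA. Qed.

Lemma smooth_cmap c : charts A c -> smooth_map A (euclid R d) (cdom c) (cmap c).
Proof.
move=> cc c1 c2 cc1 -> /=; have [oU sU] := sid cc1 cc.
rewrite (_ : _ `&` _ = setT `&` cdom c1 `&` id @^-1` cdom c) //.
by apply/seteqP; split=> x; rewrite /preimage /=; tauto.
Qed.

Lemma smooth_cinv c : charts A c ->
  smooth_map (euclid R d) A (cmap c @` cdom c) (cinv c).
Proof.
move=> cc c1 c2 -> cc2 /=; have [oU sU] := sid cc cc2.
rewrite image_idfun (_ : _ `&` _ = cmap c @` (setT `&` cdom c `&` id @^-1` cdom c2)) //.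
apply/seteqP; split=> y.
  move=> [[[x cx <-] _]]; rewrite /preimage /= (iA cc cx) => c2x.
  by exists x.
by move=> [x [[_ cx] c2x] <-]; rewrite /preimage /= (iA cc cx); do 2?split => //; exists x.
Qed.

End ChartMaps.

Section TopManifold.
Variables (R : realType) (d : nat) (T : topologicalType) (A : atlas R d T).
Hypothesis mA : is_manifold A.

Lemma chart_imageE c S : charts A c ->
  cmap c @` (S `&` cdom c) = cmap c @` cdom c `&` cinv c @^-1` S.
Proof.
move=> cc; have [_ _ _ /(_ c cc)[_ _ iA _ _] _] := mA.
apply/seteqP; split=> y.
  by move=> [x [Sx cx] <-]; split; [exists x|rewrite /preimage /= iA].
by move=> [[x cx <-]]; rewrite /preimage /= iA // => Sx; exists x.
Qed.

Lemma open_chart_open S : open S -> chart_open A S.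
Proof.
move=> oS c cc; rewrite (chart_imageE _ cc).
have [_ _ _ /(_ c cc)[_ oc _ _ ci] _] := mA.
exact: (open_preim_in oc ci oS).
Qed.

Lemma manifold_regular : regular A.
Proof.
have [_ _ cA H sA] := mA; split=> //.
  by move=> c cc x cx; have [_ _ + _ _] := H c cc; exact.
move=> c c' cc cc'.
rewrite (_ : _ `&` _ = cdom c' `&` cdom c); last first.
  by apply/seteqP; split=> x; rewrite /preimage /=; tauto.
split; last by rewrite setIC; exact: sA.
by apply: open_chart_open => //; have [] := H c' cc'.
Qed.

Lemma chart_open_open S : chart_open A S -> open S.
Proof.
move=> oS; rewrite openE => x Sx; have [_ _ cA H sA] := mA.
have [cc cx] := cA x; have [oc _ iA cm _] := H _ cc.
have oV := open_preim_in oc cm (oS _ cc).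
apply: filterS (open_nbhs_nbhs (conj oV _)); last first.
  by split => //; exists x.
by move=> y [cy [z [Sz cz]] E]; rewrite -(iA y cy) -E iA.
Qed.

End TopManifold.

Section Product.
Variables (R : realType) (d e : nat) (S T : Type).
Variables (A : atlas R d S) (B : atlas R e T).
Hypotheses (rA : regular A) (rB : regular B).
Let cA : covering A. Proof. by case: rA. Qed.
Let iA : chart_inverse A. Proof. by case: rA. Qed.
Let sA : smooth_map A A setT id. Proof. by case: rA. Qed.
Let cB : covering B. Proof. by case: rB. Qed.
Let iB : chart_inverse B. Proof. by case: rB. Qed.
Let sB : smooth_map B B setT id. Proof. by case: rB. Qed.
Local Notation AB := (prod_atlas A B).

Lemma prod_covering : covering AB.
Proof.
move=> z; have [? ?] := cA z.1; have [? ?] := cB z.2; split => //=.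
by exists (chart_at A z.1), (chart_at B z.2).
Qed.

Lemma prod_chart_inverse : chart_inverse AB.
Proof.
move=> _ [c [c' [cc cc' ->]]] [x y] [/= cx cy].
by rewrite col_mxKu col_mxKd (iA cc cx) (iB cc' cy).
Qed.

Lemma prod_image (c : chart R d S) (c' : chart R e T) (X : set S) (Y : set T) :
  (fun z : S * T => col_mx (cmap c z.1) (cmap c' z.2)) @`
    [set z | X z.1 /\ Y z.2] =
  (usubmx @^-1` (cmap c @` X)) `&` (dsubmx @^-1` (cmap c' @` Y)).
Proof.
apply/seteqP; split=> w.
  move=> [[x y] [/= Xx Yy] <-]; split; rewrite /preimage /= ?col_mxKu ?col_mxKd.
    by exists x.
  by exists y.
move=> [[x Xx Ex] [y Yy Ey]]; exists (x, y) => //=.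
by rewrite Ex Ey vsubmxK.
Qed.

Lemma regular_prod : regular AB.
Proof.
split; [exact: prod_covering|exact: prod_chart_inverse|].
move=> _ _ [c [c' [cc cc' ->]]] [c1 [c1' [cc1 cc1' ->]]].
have [oU sU] := sA cc cc1; have [oV sV] := sB cc' cc1'.
set U := (X in open X) in oU sU; set V := (X in open X) in oV sV.
have E : cmap (prod_chart c c') @` (setT `&` cdom (prod_chart c c') `&`
    id @^-1` cdom (prod_chart c1 c1')) = (usubmx @^-1` U) `&` (dsubmx @^-1` V).
  rewrite -prod_image; congr image.
  by apply/seteqP; split=> -[x y]; rewrite /preimage /=; tauto.
rewrite E; have oUV : open ((usubmx @^-1` U) `&` (dsubmx @^-1` V)).
  exact: openI (open_lin_preim (L := usubmx) oU) (open_lin_preim (L := dsubmx) oV).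
split => //; apply: (smooth_col_mx oUV).
  apply: (smooth_comp oUV _ (smooth_lin _ usubmx) sU).
  by move=> y [].
apply: (smooth_comp oUV _ (smooth_lin _ dsubmx) sV).
by move=> y [].
Qed.

Lemma smooth_fst : smooth_map AB A setT fst.
Proof.
move=> _ c1 [c [c' [cc cc' ->]]] cc1; have [oU sU] := sA cc cc1.
set U := (X in open X) in oU sU.
have oV := chart_openT rB cc'.
have E : cmap (prod_chart c c') @` (setT `&` cdom (prod_chart c c') `&`
    fst @^-1` cdom c1) =
    (usubmx @^-1` U) `&` (dsubmx @^-1` (cmap c' @` (setT `&` cdom c'))).
  rewrite -prod_image; congr image.
  by apply/seteqP; split=> -[x y]; rewrite /preimage /=; tauto.
have oUV : open ((usubmx @^-1` U) `&` (dsubmx @^-1` (cmap c' @` (setT `&` cdom c')))).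
  exact: openI (open_lin_preim (L := usubmx) oU) (open_lin_preim (L := dsubmx) oV).
rewrite E; split => //; apply: (smooth_comp oUV _ (smooth_lin _ usubmx) sU).
by move=> y [].
Qed.

(** When [x] lies outside the domain of the first factor of a product chart, the
set on which smoothness is tested is empty. *)
Lemma smooth_pair x : smooth_map B AB setT (pair x).
Proof.
move=> c' _ cc' [c1 [c1' [cc1 cc1' ->]]]; have [oV sV] := sB cc' cc1'.
set V := (X in open X) in oV sV.
have [cx|ncx] := pselect (cdom c1 x); last first.
  rewrite (_ : _ `&` _ = set0); last first.
    by apply/seteqP; split=> y; rewrite /preimage /=; tauto.
  by rewrite image_set0; split; [exact: open0|apply: smooth_local => y []].
rewrite (_ : _ `&` _ = setT `&` cdom c' `&` id @^-1` cdom c1'); last first.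
  by apply/seteqP; split=> y; rewrite /preimage /=; tauto.
split => //; apply: (smooth_col_mx oV _ sV).
exact: (@smooth_cst R _ _ _ (cmap c1 x)).
Qed.

Lemma transition_prod c c' c1 c1' z : charts A c -> charts B c' ->
  charts A c1 -> charts B c1' -> cdom (prod_chart c c') z ->
  cdom (prod_chart c1 c1') z ->
  transition (prod_chart c c') (prod_chart c1 c1') z =
  block_mx (transition c c1 z.1) 0 0 (transition c' c1' z.2).
Proof.
move=> cc cc' cc1 cc1' [cz cz'] [c1z c1z'].
have d1 := smooth_map_loc sA I cc cc1 cz c1z.
have d2 := smooth_map_loc sB I cc' cc1' cz' c1z'.
rewrite -[cmap c z.1](col_mxKu _ (cmap c' z.2)) in d1.
rewrite -[cmap c' z.2](col_mxKd (cmap c z.1)) in d2.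
apply: mulmx_cV_inj => v.
have d1' := @differentiable_comp _ _ _ _ usubmx _ _
  (linear_mx_differentiable usubmx (col_mx (cmap c z.1) (cmap c' z.2))) d1.
have d2' := @differentiable_comp _ _ _ _ dsubmx _ _
  (linear_mx_differentiable dsubmx (col_mx (cmap c z.1) (cmap c' z.2))) d2.
apply: etrans (jac_col_mx v d1' d2') _.
rewrite -[v in RHS]vsubmxK mul_block_col !mul0mx addr0 add0r; congr col_mx.
  apply: etrans (jac_comp_lin v d1) _.
  by rewrite /= col_mxKu.
apply: etrans (jac_comp_lin v d2) _.
by rewrite /= col_mxKd.
Qed.

Lemma mdiff_fst z (v : 'cV[R]_(d + e)) : mdiff AB A fst z *m v = usubmx v.
Proof.
have [ca xa] := cA z.1; have [cb xb] := cB z.2.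
have dL := linear_mx_differentiable (usubmx : 'cV[R]_(d + e) -> 'cV[R]_d)
   (cmap (chart_at AB z) z).
apply: etrans (jac_lin usubmx (cmap (chart_at AB z) z) v).
apply: (congr1 (mulmx^~ v)); apply: esym; apply: (jac_ext _ dL).
apply: (open_near (chart_openT regular_prod (prod_covering z).1)).
  by exists z => //; split => //; exact: (prod_covering z).2.
by move=> _ [[x y] [_ [/= cx cy]] <-] /=; rewrite !col_mxKu (iA ca cx).
Qed.

Lemma mdiff_pair x y (v : 'cV[R]_e) : mdiff B AB (pair x) y *m v = col_mx 0 v.
Proof.
have [ca xa] := cA x; have [cb xb] := cB y.
have d1 : differentiable (cst (cmap (chart_at A x) x) : 'cV[R]_e -> _)
  (cmap (chart_at B y) y) by exact: differentiable_cst.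
have d2 := smooth_map_loc sB I cb cb xb xb.
apply: etrans (jac_col_mx v d1 d2) _; congr col_mx.
  by rewrite (jacE v d1) derive_cst.
apply: etrans (mul1mx v); apply: (congr1 (mulmx^~ v)).
exact: (transition_refl rB cb xb).
Qed.

End Product.

(** * Linear algebra at a point of a conformal holomorphic submersion *)

Section Algebra.
Variable R : realType.

Local Notation i0 := (lshift 1 (ord0 : 'I_1)).
Local Notation i1 := (rshift 1 (ord0 : 'I_1)).

Lemma J0_entries : [/\ J0 R 1 i0 i0 = 0, J0 R 1 i0 i1 = -1,
  J0 R 1 i1 i0 = 1 & J0 R 1 i1 i1 = 0].
Proof.
by rewrite /J0; split;
   rewrite ?(block_mxEul, block_mxEur, block_mxEdl, block_mxEdr) !mxE.
Qed.

Lemma sum2 (V : zmodType) (F : 'I_(1 + 1) -> V) : \sum_i F i = F i0 + F i1.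
Proof. by rewrite big_split_ord /= !big_ord1. Qed.

Lemma ord2P (P : 'I_(1 + 1) -> Prop) : P i0 -> P i1 -> forall i, P i.
Proof.
by move=> P0 P1 i; case: (splitP i) => k E;
  [have -> : i = i0|have -> : i = i1] => //; apply: val_inj; rewrite /= E ord1.
Qed.

Lemma J0_sq n : J0 R n *m J0 R n = - 1%:M.
Proof.
rewrite /J0 mulmx_block !mul0mx !mulmx0 !mul1mx !mulmx1 !add0r !addr0.
by rewrite (scalar_mx_block n n 1) opp_block_mx !oppr0.
Qed.

Lemma J0_tr n : (J0 R n)^T = - J0 R n.
Proof.
by rewrite /J0 tr_block_mx !trmx0 trmx1 linearN /= trmx1 opp_block_mx !oppr0 opprK.
Qed.

(** A real symmetric map of the plane which is complex linear is a homothety. *)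
Lemma J0_commuting_sym_scalar (K : 'M[R]_(1 + 1)) : K^T = K ->
  J0 R 1 *m K = K *m J0 R 1 -> K = (K i0 i0)%:M.
Proof.
have [J00 J01 J10 J11] := J0_entries.
move=> sK cK; have E01 : K i0 i1 = K i1 i0 by rewrite -[in LHS]sK mxE.
have /matrixP/(_ i0 i0) := cK; have /matrixP/(_ i0 i1) := cK.
rewrite !mxE !sum2 J00 J01 J10 J11.
rewrite !(mul0r, mulr0, mulr1, mul1r, mulN1r, mulrN1, add0r, addr0) => E11 E10.
have K01 : K i0 i1 = 0.
  have : K i0 i1 *+ 2 = 0 by rewrite mulr2n -[X in X + _]E10 E01 addNr.
  by move/eqP; rewrite mulrn_eq0 /= => /eqP.
apply/matrixP => i j; rewrite [RHS]mxE; move: i j.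
apply: ord2P; apply: ord2P; rewrite ?eqxx ?mulr1n ?K01 -?E01 ?K01 //.
by rewrite -[K i1 i1]opprK E11 opprK.
Qed.

Lemma skew_form d (Z : 'M[R]_d) (X : 'cV[R]_d) : Z^T = - Z -> X^T *m Z *m X = 0.
Proof.
move=> sZ; have E : (X^T *m Z *m X)^T = - (X^T *m Z *m X).
  by rewrite !trmx_mul trmxK sZ mulNmx mulmxN mulmxA.
apply/matrixP => i j; rewrite !ord1 [RHS]mxE.
have /matrixP/(_ 0 0) := E; rewrite mxE [RHS]mxE => /eqP.
by rewrite -subr_eq0 opprK -mulr2n mulrn_eq0 /= => /eqP.
Qed.

Variables (d : nat) (G J : 'M[R]_d) (L : 'M[R]_(1 + 1, d)).
Hypotheses (symG : G^T = G)
  (posG : forall v : 'cV[R]_d, v != 0 -> 0 < (v^T *m G *m v) 0 0).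
Hypotheses (JJ : J *m J = - 1%:M) (JGJ : J^T *m G *m J = G).
Hypotheses (LJ : L *m J = J0 R 1 *m L) (surL : exists S0, L *m S0 = 1%:M).

Lemma posdef_unit : G \in unitmx.
Proof.
rewrite -row_free_unit -kermx_eq0; apply/rowV0P => v /sub_kermxP vG.
apply/eqP/negPn/negP => v0; have : v^T != 0 by rewrite trmx_eq0.
by move/posG; rewrite trmxK vG mul0mx mxE ltxx.
Qed.

Let Gi := invmx G.
Let uG := posdef_unit.

Lemma inverse_metric_sym : Gi^T = Gi. Proof. by rewrite /Gi trmx_inv symG. Qed.

Lemma JtG : J^T *m G = - (G *m J).
Proof.
apply: (canRL (@opprK _)); rewrite -[in RHS]JGJ -[RHS]mulmxA JJ.
by rewrite mulmxN mulmx1.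
Qed.

Lemma GiJt : Gi *m J^T = - (J *m Gi).
Proof.
rewrite -[LHS]mulmx1 -(mulmxV uG) -/Gi -!mulmxA [J^T *m _]mulmxA JtG.
by rewrite !mulNmx !mulmxN !mulmxA /Gi mulVmx // mul1mx.
Qed.

Lemma inverse_kahler_skew : (J *m Gi)^T = - (J *m Gi).
Proof. by rewrite trmx_mul inverse_metric_sym GiJt. Qed.

Let K := L *m Gi *m L^T.

Lemma LtJ0 : L^T *m J0 R 1 = - (J^T *m L^T).
Proof.
by rewrite -trmx_mul LJ trmx_mul J0_tr mulmxN opprK.
Qed.

(** Since [L] intertwines [J] with [J0] and [J] is orthogonal, [K] commutes with
[J0]: a holomorphic submersion onto a surface is horizontally conformal. *)
Lemma horizontally_conformal : K = (K i0 i0)%:M.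
Proof.
apply: J0_commuting_sym_scalar; first by rewrite /K !trmx_mul trmxK inverse_metric_sym mulmxA.
rewrite /K -[RHS]mulmxA LtJ0 mulmxN [in RHS]mulmxA -[L *m Gi *m J^T]mulmxA GiJt.
by rewrite mulmxN mulNmx opprK !mulmxA -LJ.
Qed.

Lemma dilation_gt0 : 0 < K i0 i0.
Proof.
pose v := Gi *m L^T *m delta_mx i0 (0 : 'I_1).
have -> : K i0 i0 = (v^T *m G *m v) 0 0.
  rewrite /v !trmx_mul !trmxK inverse_metric_sym -!mulmxA [G *m _]mulmxA mulmxV // mul1mx.
  rewrite trmx_delta (_ : L *m _ = K *m delta_mx i0 0); last by rewrite !mulmxA.
  by rewrite -rowE -colE !mxE.
apply: posG; apply/negP => /eqP v0; have [S0 LS0] := surL.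
have : S0^T *m G *m v = 0 by rewrite v0 mulmx0.
rewrite /v !mulmxA -(mulmxA _ G) mulmxV // mulmx1 -trmx_mul LS0 trmx1 mul1mx.
by move/matrixP/(_ i0 0)/eqP; rewrite !mxE !eqxx oner_eq0.
Qed.

(* [A X] plays the role of the covariant derivative of [J] along [X]: it
   vanishes on the fibres and is complex linear in [X].  [N i a j] plays the
   role of the second fundamental form of the submersion, and [NA] is the
   covariant derivative of [LJ]. *)
Variable A : 'cV[R]_d -> 'M[R]_d.
Hypotheses (linA : linear A)
  (AJ : forall X, A X *m J = - (J *m A X))
  (skA : forall X, (A X)^T *m G = - (G *m A X))
  (kerA : forall X, L *m X = 0 -> A X = 0)
  (holA : forall X, A (J *m X) = J *m A X).
Variable N : 'I_d -> 'M[R]_(1 + 1, d).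
Hypotheses (symN : forall i j a, N i a j = N j a i)
  (NA : forall i, J0 R 1 *m N i = N i *m J + L *m A (ebasis R i)).

(* [mu] is the square of the dilation of [L], and [S] its horizontal lift. *)
Let mu := K i0 i0.
Let S := mu^-1 *: (Gi *m L^T).

Lemma lift_section : L *m S = 1%:M.
Proof.
rewrite /S -scalemxAr mulmxA -/K horizontally_conformal -/mu scale_scalar_mx mulVf //.
by rewrite gt_eqF // dilation_gt0.
Qed.

Lemma lift_J0 : J *m S = S *m J0 R 1.
Proof.
rewrite /S -scalemxAr -scalemxAl; congr (_ *: _).
by rewrite -[RHS]mulmxA LtJ0 mulmxN [in RHS]mulmxA GiJt mulNmx opprK mulmxA.
Qed.

Let X := S *m delta_mx i0 (0 : 'I_1).

(** The lifts of the standard frame of the plane form a frame [X], [J X] of the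
horizontal space. *)
Lemma lift_frame : J *m X = S *m delta_mx i1 (0 : 'I_1).
Proof.
rewrite /X mulmxA lift_J0 -mulmxA; congr (S *m _).
have [J00 J01 J10 J11] := J0_entries.
rewrite -colE; apply/matrixP; apply: ord2P => j;
by rewrite (ord1 j) [LHS]mxE [RHS]mxE ?J00 ?J10.
Qed.

(** As [A X] is skew and anticommutes with [J], the vector [A X *m X] is
orthogonal to both [X] and [J *m X], hence vertical. *)
Lemma proj_nabla_XX : L *m A X *m X = 0.
Proof.
have StG : L = mu *: (S^T *m G).
  rewrite /S linearZ /= -scalemxAl scalerA mulfV ?scale1r; last first.
    by rewrite gt_eqF // dilation_gt0.
  by rewrite trmx_mul trmxK inverse_metric_sym /Gi mulmxKV.
have sk1 : (G *m A X)^T = - (G *m A X) by rewrite trmx_mul symG skA.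
have sk2 : (J^T *m G *m A X)^T = - (J^T *m G *m A X).
  rewrite [in RHS]JtG mulNmx opprK !trmx_mul trmxK symG.
  by rewrite mulmxA skA mulNmx -mulmxA AJ mulmxN opprK mulmxA.
rewrite StG -!scalemxAl; apply/eqP; rewrite scaler_eq0; apply/orP; right.
apply/eqP/matrixP => i j; rewrite ord1 [RHS]mxE {j}.
have E (v : 'cV[R]_d) a : v = S *m delta_mx a (0 : 'I_1) ->
    (S^T *m G *m A X *m X) a 0 = (v^T *m G *m A X *m X) 0 0.
  move=> ->; rewrite trmx_mul trmx_delta -!(mulmxA (delta_mx 0 a)) -rowE.
  by rewrite [RHS]mxE.
move: i; apply: ord2P.
  by rewrite (E X) // -(mulmxA _ G) (skew_form _ sk1) mxE.
rewrite (E _ _ lift_frame) trmx_mul.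
have := skew_form X sk2; rewrite (mulmxA X^T (J^T *m G)) (mulmxA X^T J^T) => ->.
by rewrite mxE.
Qed.

(** [A] vanishes on vertical vectors, so only the horizontal part of [v] counts. *)
Lemma A_factor v : A v = (L *m v) i0 0 *: A X + (L *m v) i1 0 *: (J *m A X).
Proof.
have A0 : A 0 = 0 by apply: kerA; rewrite mulmx0.
have -> : A v = A (S *m (L *m v)).
  have -> : v = 1 *: (S *m (L *m v)) + (v - S *m (L *m v)).
    by rewrite scale1r addrC subrK.
  rewrite linA scale1r [X in _ + X]kerA ?addr0; last first.
    by rewrite mulmxBr mulmxA lift_section mul1mx subrr.
  by rewrite scale1r [_ + (v - _)]addrC subrK.
have -> : S *m (L *m v) = (L *m v) i0 0 *: X + ((L *m v) i1 0 *: (J *m X) + 0).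
  rewrite addr0 lift_frame /X !scalemxAr -mulmxDr; congr (S *m _).
  apply/matrixP; apply: ord2P => j;
  by rewrite (ord1 j) !mxE !eqxx /= ?mulr1 ?mulr0 ?addr0 ?add0r.
by rewrite !linA A0 addr0 holA.
Qed.

(** Contract the identity [NA], applied to [J w], with the inverse metric.  The
term in [N] disappears, because [N] is symmetric and [J *m Gi] is skew.  By
[A_factor] the other term is a sum over the frame [X], [J X]; since
[A (J X) = J (A X)], both summands are the same multiple of
[L *m (J *m A X *m X)], which is 0 by [proj_nabla_XX]. *)
Lemma tension_eq0 (a : 'I_(1 + 1)) : \sum_i \sum_j Gi i j * N i a j = 0.
Proof.
pose w i := col i Gi.
have -> : \sum_i \sum_j Gi i j * N i a j = (\sum_i N i *m w i) a 0.
  rewrite summxE; apply: eq_bigr => i _; rewrite [RHS]mxE.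
  apply: eq_bigr => j _; rewrite mxE mulrC; congr (_ * _).
  by rewrite -[in LHS]inverse_metric_sym mxE.
have NE i : N i *m w i = L *m A (ebasis R i) *m (J *m w i)
     - J0 R 1 *m (N i *m (J *m w i)).
  rewrite [J0 R 1 *m (N i *m _)]mulmxA NA mulmxDl opprD addrCA subrr addr0.
  by rewrite -[N i *m J *m _]mulmxA [J *m (J *m _)]mulmxA JJ mulNmx mul1mx mulmxN opprK.
rewrite (eq_bigr _ (fun i _ => NE i)) sumrB -mulmx_sumr.
have -> : \sum_i N i *m (J *m w i) = 0.
  apply/matrixP => b j; rewrite ord1 summxE [RHS]mxE.
  have E : \sum_i (N i *m (J *m w i)) b 0 = \sum_i \sum_j N i b j * (J *m Gi) j i.
    apply: eq_bigr => i _; rewrite mxE; apply: eq_bigr => k _.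
    by rewrite /w colE mulmxA -colE mxE.
  have E2 : \sum_i \sum_j N i b j * (J *m Gi) j i =
          - \sum_i \sum_j N i b j * (J *m Gi) j i.
    rewrite [LHS]exchange_big -sumrN; apply: eq_bigr => i _.
    rewrite -sumrN; apply: eq_bigr => k _; rewrite symN -mulrN; congr (_ * _).
    by rewrite -[in LHS](trmxK (J *m Gi)) inverse_kahler_skew !mxE.
  rewrite E; move/eqP: E2.
  by rewrite -subr_eq0 opprK -mulr2n mulrn_eq0 /= => /eqP.
rewrite mulmx0 subr0.
have -> : \sum_i L *m A (ebasis R i) *m (J *m w i) =
   L *m (A X *m (J *m (Gi *m L^T *m delta_mx i0 0)) +
         J *m A X *m (J *m (Gi *m L^T *m delta_mx i1 0))).
  have wE (b : 'I_(1 + 1)) : Gi *m L^T *m delta_mx b (0 : 'I_1) =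
      \sum_i (L *m ebasis R i) b 0 *: w i.
    rewrite -mulmxA -colE; apply/matrixP => k j; rewrite ord1 mxE summxE.
    by apply: eq_bigr => i _; rewrite /ebasis -colE !mxE mulrC.
  rewrite mulmxDr !wE !mulmx_sumr -big_split /=; apply: eq_bigr => i _.
  rewrite A_factor mulmxDr mulmxDl.
  by congr (_ + _); rewrite -!scalemxAr -!scalemxAl !mulmxA.
have GLS (b : 'I_(1 + 1)) : Gi *m L^T *m delta_mx b (0 : 'I_1) =
    mu *: (S *m delta_mx b 0).
  rewrite /S -scalemxAl scalerA mulfV ?scale1r //.
  by rewrite gt_eqF // dilation_gt0.
rewrite !GLS -lift_frame -/X -!scalemxAr [J *m (J *m X)]mulmxA JJ mulNmx mul1mx.
rewrite !mulmxN [A X *m (J *m X)]mulmxA AJ mulNmx -scalerDr -opprD.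
have L0 : L *m (J *m A X *m X) = 0.
  by rewrite !mulmxA LJ -!mulmxA [L *m _]mulmxA proj_nabla_XX mulmx0.
by rewrite -scalemxAr mulmxN mulmxDr L0 addr0 oppr0 scaler0 mxE.
Qed.

End Algebra.

(** * The Levi-Civita connection and the Laplacian in a chart *)

Section MatrixDerivatives.
Variables (R : realType) (V : normedModType R).

Lemma derive_entry m n (f : V -> 'M[R]_(m, n)) x v i j : differentiable f x ->
  ('D_v f x) i j = 'D_v (fun y => f y i j : R^o) x.
Proof.
by move=> df; rewrite (derive_mx (@diff_derivable _ _ _ _ _ v df)) mxE.
Qed.

Lemma derive_linear (W X : normedModType R) (L : {linear W -> X}) (f : V -> W) x v :
  continuous L -> differentiable f x ->
  'D_v (fun y => L (f y)) x = L ('D_v f x).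
Proof.
move=> cL df; have dL : differentiable L (f x) by exact: linear_differentiable.
have dLf := differentiable_comp df dL.
apply: etrans (deriveE v dLf) _; rewrite (diff_comp df dL) /= (diff_lin _ cL).
by rewrite (deriveE v df).
Qed.

Lemma derive_bigsum (W : normedModType R) n (f : 'I_n -> V -> W) x v :
  (forall i, differentiable (f i) x) ->
  'D_v (fun y => \sum_i f i y) x = \sum_i 'D_v (f i) x.
Proof.
move=> df; rewrite -derive_sum; last by move=> i; exact: diff_derivable (df i).
by congr (derive _ x v); apply/funext => y; rewrite fct_sumE.
Qed.

Lemma derive_mul (f g : V -> R^o) x v : differentiable f x -> differentiable g x ->
  'D_v (fun y => f y * g y : R^o) x = 'D_v f x * g x + f x * 'D_v g x.
Proof.
move=> df dg.
have := deriveM (@diff_derivable _ _ _ _ _ v df) (@diff_derivable _ _ _ _ _ v dg).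
by rewrite addrC [g x *: _]mulrC; exact.
Qed.

Lemma differentiable_mulmx m n p (A : V -> 'M[R]_(m, n)) (B : V -> 'M[R]_(n, p)) x :
  differentiable A x -> differentiable B x ->
  differentiable (fun y => A y *m B y) x.
Proof.
move=> dA dB; apply: differentiable_mx => i j.
rewrite (_ : (fun _ => _) = (fun y => \sum_k (A y i k * B y k j : R^o))); last first.
  by apply/funext => y; rewrite mxE.
apply: differentiable_bigsum => k.
exact: differentiableM (differentiable_entry i k dA) (differentiable_entry k j dB).
Qed.

Lemma derive_mulmx m n p (A : V -> 'M[R]_(m, n)) (B : V -> 'M[R]_(n, p)) x v :
  differentiable A x -> differentiable B x ->
  'D_v (fun y => A y *m B y) x = 'D_v A x *m B x + A x *m 'D_v B x.
Proof.
move=> dA dB; apply/matrixP => i j.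
rewrite (derive_entry v i j (differentiable_mulmx dA dB)).
rewrite (_ : (fun _ => _) = (fun y => \sum_k (A y i k * B y k j : R^o))); last first.
  by apply/funext => y; rewrite mxE.
have dAi k := differentiable_entry i k dA.
have dBj k := differentiable_entry k j dB.
rewrite derive_bigsum; last by move=> k; exact: differentiableM (dAi k) (dBj k).
rewrite mxE [X in X + _]mxE [X in _ + X]mxE -big_split; apply: eq_bigr => k _.
rewrite (derive_mul v (dAi k) (dBj k)).
by rewrite -(derive_entry v i k dA) -(derive_entry v k j dB).
Qed.

Lemma derive_near_eq (W : normedModType R) (U : set V) (f g : V -> W) x v :
  open U -> U x -> (forall y, U y -> f y = g y) -> 'D_v f x = 'D_v g x.
Proof.
move=> oU Ux fg; apply: near_eq_derive.
by apply: (open_near oU Ux) => y /fg.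
Qed.

End MatrixDerivatives.

Section Christoffel.
Variables (R : realType) (d : nat).
Implicit Types (G : 'cV[R]_d -> 'M[R]_d).

(** The Christoffel symbol [Gamma^k_ij] of a metric given in coordinates. *)
Definition levi_civita G y (k i j : 'I_d) : R :=
  let dG (a b e : 'I_d) := 'D_(ebasis R a) G y b e in
  2^-1 * \sum_(l < d) invmx (G y) k l * (dG i j l + dG j i l - dG l i j).

Definition christoffel_mx G y (i : 'I_d) : 'M[R]_d :=
  \matrix_(k, j) levi_civita G y k i j.

Variables (G : 'cV[R]_d -> 'M[R]_d) (U : set 'cV[R]_d) (y : 'cV[R]_d).
Hypotheses (oU : open U) (Uy : U y) (dG : differentiable G y).
Hypotheses (symG : forall z, U z -> (G z)^T = G z) (uG : G y \in unitmx).

Lemma dG_sym v : ('D_v G y)^T = 'D_v G y.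
Proof.
have ct : continuous (trmx : {linear 'M[R]_d -> 'M[R]_d}).
  exact: linear_mx_continuous.
apply: etrans (esym (derive_linear v ct dG)) _.
exact: (derive_near_eq v oU Uy symG).
Qed.

Lemma levi_civita_sym k i j : levi_civita G y k i j = levi_civita G y k j i.
Proof.
congr (_ * _); apply: eq_bigr => l _; congr (_ * (_ - _)); first exact: addrC.
by rewrite -[in LHS]dG_sym mxE.
Qed.

(** The covariant derivative of the metric is 0.  Lowering the index of the
Christoffel symbols cancels the inverse matrix, and two of the three
derivatives of [G] cancel after symmetrisation. *)
Lemma metric_compatible i :
  'D_(ebasis R i) G y = (christoffel_mx G y i)^T *m G y + G y *m christoffel_mx G y i.
Proof.
pose D a b e := ('D_(ebasis R a) G y) b e.
have sD a b e : D a b e = D a e b by rewrite /D -[in LHS]dG_sym mxE.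
have E b e : (G y *m christoffel_mx G y i) b e = 2^-1 * (D i e b + D e i b - D b i e).
  rewrite mxE.
  transitivity (\sum_k \sum_l 2^-1 * (G y b k * invmx (G y) k l) *
      (D i e l + D e i l - D l i e)).
    apply: eq_bigr => k _; rewrite mxE /levi_civita mulrCA !mulr_sumr.
    by apply: eq_bigr => l _; rewrite !mulrA.
  rewrite exchange_big (bigD1 b) //= [X in _ + X]big1 ?addr0.
    rewrite -mulr_suml -mulr_sumr; congr (_ * _).
    have /matrixP/(_ b b) := mulmxV uG; rewrite !mxE eqxx => ->.
    by rewrite mulr1.
  move=> l lb; rewrite -mulr_suml -mulr_sumr.
  have /matrixP/(_ b l) := mulmxV uG; rewrite !mxE eq_sym (negPf lb) => ->.
  by rewrite mulr0 mul0r.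
apply/matrixP => b e; rewrite [RHS]mxE E.
have -> : ((christoffel_mx G y i)^T *m G y) b e = (G y *m christoffel_mx G y i) e b.
  by rewrite -[in LHS](symG Uy) -trmx_mul mxE.
have abel (p q r : R) : p + q - r + (p + r - q) = p *+ 2 by ring.
rewrite E -mulrDr (sD i e b) abel -[LHS]/(D i b e).
by rewrite mulrnAr -mulrnAl -[2^-1 *+ 2]mulr_natr mulVf ?mul1r // pnatr_eq0.
Qed.

End Christoffel.

Section ChartLaplacian.
Variable R : realType.
Local Notation i0 := (lshift 1 (ord0 : 'I_1)).
Local Notation i1 := (rshift 1 (ord0 : 'I_1)).

Definition flat_laplacian (phi : 'cV[R]_(1 + 1) -> R^o) x : R :=
  'D_(ebasis R i0) ('D_(ebasis R i0) phi) x +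
  'D_(ebasis R i1) ('D_(ebasis R i1) phi) x.

Definition metric_laplacian d (G : 'cV[R]_d -> 'M[R]_d) (u : 'cV[R]_d -> R^o) y : R :=
  \sum_(i < d) \sum_(j < d) invmx (G y) i j *
    ('D_(ebasis R i) ('D_(ebasis R j) u) y -
     \sum_(k < d) levi_civita G y k i j * 'D_(ebasis R k) u y).

(** Such a metric is [la%:M] for a positive function [la]; the traces of its
Christoffel symbols vanish in dimension 2, so that its Laplacian is the flat
one divided by [la]. *)
Lemma conformal_laplacian (G : 'cV[R]_(1 + 1) -> 'M[R]_(1 + 1)) U phi y :
  open U -> U y -> differentiable G y ->
  (forall z, U z -> (G z)^T = G z) ->
  (forall v : 'cV[R]_(1 + 1), v != 0 -> 0 < (v^T *m G y *m v) 0 0) ->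
  (forall z, U z -> (J0 R 1)^T *m G z *m J0 R 1 = G z) ->
  metric_laplacian G phi y = 0 -> flat_laplacian phi y = 0.
Proof.
move=> oU Uy dG symG posG JGJ.
pose la z := G z i0 i0.
have GE z : U z -> G z = (la z)%:M.
  move=> Uz; apply: J0_commuting_sym_scalar; first exact: symG.
  rewrite -[in LHS](JGJ z Uz) !mulmxA.
  by rewrite J0_tr mulmxN J0_sq opprK mul1mx.
have la0 : la y != 0.
  have : (delta_mx i0 0 : 'cV[R]_(1 + 1)) != 0.
    by apply/negP => /eqP/matrixP/(_ i0 0)/eqP; rewrite !mxE !eqxx oner_eq0.
  move/posG; rewrite trmx_delta -rowE -colE !mxE => H.
  by rewrite gt_eqF.
have dGE a b e : 'D_(ebasis R a) G y b e = 'D_(ebasis R a) la y *+ (b == e).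
  rewrite (derive_entry _ _ _ dG).
  have [->|be] := eqVneq b e.
    apply: (derive_near_eq _ oU Uy) => z Uz.
    by rewrite (GE z Uz) mxE eqxx.
  rewrite mulr0n; apply: etrans (derive_near_eq (g := cst 0) _ oU Uy _) _.
    by move=> z Uz; rewrite (GE z Uz) mxE (negPf be).
  by rewrite derive_cst.
have GiE : invmx (G y) = (la y)^-1%:M by rewrite (GE y Uy) invmx_scalar.
pose D a : R := 'D_(ebasis R a) la y.
have lcE k i j : levi_civita G y k i j =
    2^-1 * ((la y)^-1 * (D i *+ (j == k) + D j *+ (i == k) - D k *+ (i == j))).
  rewrite /levi_civita; congr (_ * _); rewrite (bigD1 k) //= [X in _ + X]big1.
    rewrite addr0; congr (_ * _); first by rewrite GiE mxE eqxx.
    by congr (_ + _ - _); exact: dGE.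
  move=> l lk; rewrite [X in X * _](_ : _ = 0) ?mul0r // GiE mxE eq_sym.
  by rewrite (negPf lk).
have tr0 k : levi_civita G y k i0 i0 + levi_civita G y k i1 i1 = 0.
  rewrite !lcE -!mulrDr [X in _ * (_ * X)](_ : _ = 0) ?mulr0 //.
  have E0 (p : R) : p + p - p + (0 + 0 - p) = 0 by ring.
  have E1 (q : R) : 0 + 0 - q + (q + q - q) = 0 by ring.
  move: k; apply: ord2P; rewrite !eqxx /= !mulr1n !mulr0n.
    exact: (E0 (D i0)).
  exact: (E1 (D i1)).
rewrite /metric_laplacian !sum2 GiE !mxE !eqxx /= !mulr1n !mulr0n !mul0r addr0 add0r.
rewrite -mulrDr => /eqP; rewrite mulf_eq0 invr_eq0 (negPf la0) /= => /eqP.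
have E (a b p q r s u v : R) : a - (p * u + q * v) + (b - (r * u + s * v)) =
    a + b - ((p + r) * u + (q + s) * v) by ring.
by rewrite E !tr0 !mul0r addr0 subr0.
Qed.

Section Composite.
Variables (d : nat) (U : set 'cV[R]_d) (U' : set 'cV[R]_(1 + 1)).
Variables (F : 'cV[R]_d -> 'cV[R]_(1 + 1)) (phi : 'cV[R]_(1 + 1) -> R^o).
Variable y : 'cV[R]_d.
Hypotheses (oU : open U) (Uy : U y) (FU : forall z, U z -> U' (F z)).
Hypotheses (sF : smooth_on U F) (sphi : smooth_on U' phi).

Let H i j a := ('D_(ebasis R i) ('D_(ebasis R j) F) y) a 0.

Lemma derive_comp1 z j : U z -> 'D_(ebasis R j) (phi \o F) z =
  \sum_a (('D_(ebasis R j) F z) a 0 : R^o) * 'D_(ebasis R a) phi (F z).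
Proof.
move=> Uz; apply: deriv_comp_sum; first exact: smooth_differentiable sF Uz.
exact: smooth_differentiable sphi (FU Uz).
Qed.

Lemma derive_comp2 i j :
  'D_(ebasis R i) ('D_(ebasis R j) (phi \o F)) y =
  \sum_a (H i j a * 'D_(ebasis R a) phi (F y) +
     ('D_(ebasis R j) F y) a 0 * \sum_b ('D_(ebasis R i) F y) b 0 *
        'D_(ebasis R b) ('D_(ebasis R a) phi) (F y)).
Proof.
apply: etrans (derive_near_eq _ oU Uy (fun z => @derive_comp1 z j)) _.
have dF := smooth_differentiable sF Uy.
have dDF := smooth_differentiable (smooth_derive (ebasis R j) sF) Uy.
have d1 a := differentiable_entry a 0 dDF.
have dphi a := smooth_differentiable (smooth_derive (ebasis R a) sphi) (FU Uy).
have d2 a := differentiable_comp dF (dphi a).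
rewrite derive_bigsum; last by move=> a; exact: differentiableM (d1 a) (d2 a).
apply: eq_bigr => a _; apply: etrans (derive_mul _ (d1 a) (d2 a)) _.
congr (_ * _ + _ * _); first by rewrite -(derive_entry _ a 0 dDF).
exact: (deriv_comp_sum _ dF (dphi a)).
Qed.

Lemma hessian_sym i j a : H i j a = H j i a.
Proof.
have E k l : H k l a = 'D_(ebasis R k) ('D_(ebasis R l) (fun z => F z a 0 : R^o)) y.
  rewrite /H (derive_entry _ a 0 (smooth_differentiable (smooth_derive (ebasis R l) sF) Uy)).
  apply: (derive_near_eq _ oU Uy) => z Uz.
  exact: derive_entry (smooth_differentiable sF Uz).
rewrite !E; apply: (schwarz _ _ oU Uy).
exact: (smooth_comp_lin (@mx_entry R (1 + 1) 1 a 0) oU sF).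
Qed.

End Composite.
End ChartLaplacian.

(** * The tension field in a chart *)

Lemma contract_bilinear (R : comPzRingType) (I K : finType) (g : I -> I -> R)
    (n : I -> K -> I -> R) (p : K -> R) (l : K -> I -> R) (q : K -> K -> R) :
  \sum_i \sum_j g i j * \sum_a (n i a j * p a + \sum_b l b i * l a j * q b a) =
  \sum_a ((\sum_i \sum_j g i j * n i a j) * p a +
    \sum_b (\sum_i \sum_j g i j * (l b i * l a j)) * q b a).
Proof.
under eq_bigr => i _ do under eq_bigr => j _ do rewrite mulr_sumr.
under eq_bigr => i _ do rewrite exchange_big.
rewrite exchange_big /=; apply: eq_bigr => a _.
under eq_bigr => i _ do under eq_bigr => j _ do rewrite mulrDr mulrA mulr_sumr.
under eq_bigr => i _ do rewrite big_split /= exchange_big /=.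
rewrite big_split /= exchange_big /= mulr_suml; congr (_ + _).
  rewrite exchange_big /=; apply: eq_bigr => i _; rewrite mulr_suml.
  by apply: eq_bigr.
rewrite exchange_big /=; apply: eq_bigr => b _; rewrite mulr_suml.
apply: eq_bigr => i _; rewrite mulr_suml; apply: eq_bigr => j _.
by rewrite mulrA.
Qed.

Lemma trace_scalar2 (R : realType) (K : 'M[R]_(1 + 1)) mu
    (Q : 'I_(1 + 1) -> 'I_(1 + 1) -> R) : K = mu%:M ->
  Q (lshift 1 ord0) (lshift 1 ord0) + Q (rshift 1 ord0) (rshift 1 ord0) = 0 ->
  \sum_a \sum_b K b a * Q b a = 0.
Proof.
move=> -> Q0; rewrite !sum2 ![mu%:M _ _]mxE !eqxx /= !mulr0n !mulr1n !mul0r.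
by rewrite addr0 add0r -mulrDr Q0 mulr0.
Qed.

Section ChartTension.
Variable R : realType.

Definition connection_mx d (G : 'cV[R]_d -> 'M[R]_d) y (X : 'cV[R]_d) : 'M[R]_d :=
  \matrix_(k, j) \sum_(i < d) X i 0 * levi_civita G y k i j.

Lemma connection_mxE d (G : 'cV[R]_d -> 'M[R]_d) y X :
  connection_mx G y X = \sum_i X i 0 *: christoffel_mx G y i.
Proof.
apply/matrixP => k j; rewrite summxE [LHS]mxE; apply: eq_bigr => i _.
by rewrite [RHS]mxE [christoffel_mx _ _ _ _ _]mxE.
Qed.

Lemma connection_mx_basis d (G : 'cV[R]_d -> 'M[R]_d) y i :
  connection_mx G y (ebasis R i) = christoffel_mx G y i.
Proof.
rewrite connection_mxE (bigD1 i) //= [X in _ + X]big1 ?addr0.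
  by rewrite mxE !eqxx scale1r.
by move=> j ji; rewrite mxE (negPf ji) scale0r.
Qed.

Lemma connection_mx_linear d (G : 'cV[R]_d -> 'M[R]_d) y : linear (connection_mx G y).
Proof.
move=> a u v; rewrite !connection_mxE scaler_sumr -big_split; apply: eq_bigr => i _ /=.
by rewrite !mxE scalerDl scalerA.
Qed.

Lemma derive_basis (W : normedModType R) d (f : 'cV[R]_d -> W) y v :
  differentiable f y -> 'D_v f y = \sum_i v i 0 *: 'D_(ebasis R i) f y.
Proof.
move=> df; apply: etrans (deriveE v df) _; rewrite matrix_delta_sum.
by apply: eq_bigr => i _; rewrite big_ord1; congr (_ *: _); apply/esym/deriveE.
Qed.

Variables (d : nat) (U : set 'cV[R]_d) (U' : set 'cV[R]_(1 + 1)).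
Variables (F : 'cV[R]_d -> 'cV[R]_(1 + 1)) (phi : 'cV[R]_(1 + 1) -> R^o).
Variable y : 'cV[R]_d.
Hypotheses (oU : open U) (Uy : U y) (FU : forall z, U z -> U' (F z)).
Hypotheses (sF : smooth_on U F) (sphi : smooth_on U' phi).
Variables G Jc : 'cV[R]_d -> 'M[R]_d.
Hypotheses (dG : differentiable G y) (dJ : differentiable Jc y).
Hypotheses (symG : forall z, U z -> (G z)^T = G z)
  (posG : forall v : 'cV[R]_d, v != 0 -> 0 < (v^T *m G y *m v) 0 0).
Hypotheses (JJ : forall z, U z -> Jc z *m Jc z = - 1%:M)
  (JGJ : forall z, U z -> (Jc z)^T *m G z *m Jc z = G z)
  (FJ : forall z, U z -> jac F z *m Jc z = J0 R 1 *m jac F z).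
Hypothesis surF : exists S0, jac F y *m S0 = 1%:M.

Let Ga := connection_mx G y.
(** The covariant derivative along [X] of the field of endomorphisms [Jc]. *)
Definition cov_J X := 'D_X Jc y + (Ga X *m Jc y - Jc y *m Ga X).
Let A := cov_J.
Hypotheses (kerA : forall X, jac F y *m X = 0 -> A X = 0)
  (holA : forall X, A (Jc y *m X) = Jc y *m A X).

Let uG : G y \in unitmx. Proof. exact: posdef_unit posG. Qed.

(** The covariant derivative of [G] vanishes along every vector; [cov_J_skew]
uses this form. *)
Lemma metric_compatible_dir X : 'D_X G y = (Ga X)^T *m G y + G y *m Ga X.
Proof.
rewrite (derive_basis X dG) /Ga connection_mxE linear_sum mulmx_suml mulmx_sumr.
rewrite -big_split; apply: eq_bigr => i _ /=.
rewrite (metric_compatible oU Uy dG symG uG i) linearZ /= -scalemxAl -scalemxAr.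
by rewrite scalerDr.
Qed.

Lemma cov_J_linear : linear A.
Proof.
move=> a u v; rewrite /A /cov_J.
have -> : 'D_(a *: u + v) Jc y = a *: 'D_u Jc y + 'D_v Jc y.
  by rewrite !(deriveE _ dJ) linearP.
rewrite /Ga connection_mx_linear mulmxDl mulmxDr -scalemxAl -scalemxAr.
have abel (p q b c e h : 'M[R]_d) :
    p + q + (b + c - (e + h)) = p + (b - e) + (q + (c - h)).
  by rewrite opprD !addrA (ACl (1*3*5*2*4*6)).
by rewrite scalerDr scalerBr; exact: abel.
Qed.

(** Differentiate [J o J = - id]; the commutator with the connection matrix
anticommutes with [J] as well. *)
Lemma cov_J_anti X : A X *m Jc y = - (Jc y *m A X).
Proof.
have E : 'D_X Jc y *m Jc y + Jc y *m 'D_X Jc y = 0.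
  rewrite -(derive_mulmx X dJ dJ).
  apply: etrans (derive_near_eq (g := cst (- 1%:M)) X oU Uy JJ) _.
  by rewrite derive_cst.
apply/eqP; rewrite -subr_eq0 opprK; apply/eqP.
rewrite /A /cov_J mulmxDl mulmxDr addrACA E add0r mulmxBl mulmxBr.
have e1 : Ga X *m Jc y *m Jc y = - Ga X by rewrite -mulmxA (JJ Uy) mulmxN mulmx1.
have e2 : Jc y *m Jc y *m Ga X = - Ga X by rewrite (JJ Uy) mulNmx mul1mx.
by rewrite !mulmxA e1 e2 addrA subrK opprK addNr.
Qed.

Let JtG0 := JtG (JJ Uy) (JGJ Uy).

(** Differentiate the orthogonality of [J], using that the metric is parallel, to
get [A^T G J + J^T G A = 0]; then [cov_J_anti] moves [J] across [A]. *)
Lemma cov_J_skew X : (A X)^T *m G y = - (G y *m A X).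
Proof.
have dJt : differentiable (fun z => (Jc z)^T) y.
  apply: (@differentiable_comp _ _ _ _ Jc (trmx : {linear 'M[R]_d -> 'M[R]_d}) y dJ).
  exact: (linear_mx_differentiable (trmx : {linear 'M[R]_d -> 'M[R]_d})).
have DJt : 'D_X (fun z => (Jc z)^T) y = ('D_X Jc y)^T.
  apply: (derive_linear (L := (trmx : {linear 'M[R]_d -> 'M[R]_d})) X _ dJ).
  exact: linear_mx_continuous.
have dJtG := differentiable_mulmx dJt dG.
have E : ('D_X Jc y)^T *m G y *m Jc y + (Jc y)^T *m 'D_X G y *m Jc y +
   (Jc y)^T *m G y *m 'D_X Jc y = 'D_X G y.
  apply: etrans _ (derive_near_eq X oU Uy JGJ).
  rewrite (derive_mulmx X dJtG dJ).
  by rewrite (derive_mulmx X dJt dG) mulmxDl DJt.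
have Jt : (Jc y)^T *m G y *m Jc y = G y := JGJ Uy.
have e1 : (A X)^T *m G y *m Jc y = ('D_X Jc y)^T *m G y *m Jc y +
    (Jc y)^T *m (Ga X)^T *m G y *m Jc y - (Ga X)^T *m G y.
  rewrite -[in X in _ - X]Jt /A /cov_J !linearD linearN /= !trmx_mul.
  by rewrite !mulmxDl !mulNmx !mulmxA addrA.
have e2 : (Jc y)^T *m G y *m A X = (Jc y)^T *m G y *m 'D_X Jc y +
    (Jc y)^T *m G y *m Ga X *m Jc y - G y *m Ga X.
  by rewrite -[in X in _ - X]Jt /A /cov_J !mulmxDr mulmxN !mulmxA addrA.
have abel (a b c e g h : 'M[R]_d) :
    a + b - g + (c + e - h) = a + (b + e) + c - (g + h).
  by rewrite opprD !addrA (ACl (1*2*5*4*3*6)).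
have H : (A X)^T *m G y *m Jc y + (Jc y)^T *m G y *m A X = 0.
  rewrite e1 e2 abel; apply/eqP; rewrite subr_eq0; apply/eqP.
  by rewrite -metric_compatible_dir -[RHS]E metric_compatible_dir mulmxDr mulmxDl !mulmxA.
rewrite JtG0 mulNmx -[G y *m Jc y *m _]mulmxA in H.
have H2 : (A X)^T *m G y *m Jc y = G y *m (Jc y *m A X).
  by apply/eqP; rewrite -subr_eq0; apply/eqP.
rewrite -[Jc y *m A X]opprK -cov_J_anti mulmxN mulmxA -mulNmx in H2.
rewrite -[LHS]mulmx1 -[RHS]mulmx1 -[1%:M]opprK -(JJ Uy) !mulmxN !mulmxA.
by rewrite H2.
Qed.

Let L := jac F y.
Let H i j a := ('D_(ebasis R i) ('D_(ebasis R j) F) y) a 0.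
(* The second fundamental form of [F], that is its covariant Hessian, along the
   [i]-th coordinate vector. *)
Let N i : 'M[R]_(1 + 1, d) := \matrix_(a, j) H i j a - L *m christoffel_mx G y i.

Lemma tension_entry i a j :
  N i a j = H i j a - \sum_k L a k * levi_civita G y k i j.
Proof.
rewrite /N [LHS]mxE [X in X + _]mxE [X in _ + X]mxE; congr (_ - _).
rewrite [LHS]mxE; apply: eq_bigr => k _; apply: (congr1 ( *%R (L a k))).
by rewrite [LHS]mxE.
Qed.

(** Symmetry of second derivatives, and of the Christoffel symbols. *)
Lemma tension_sym i j a : N i a j = N j a i.
Proof.
rewrite (tension_entry i a j) (tension_entry j a i).
apply: (congr2 (fun p q : R => p - q)); first exact: (hessian_sym oU Uy sF i j a).
apply: eq_bigr => k _; apply: (congr1 ( *%R (L a k))).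
exact: (levi_civita_sym oU Uy dG symG k i j).
Qed.

Lemma jac_col z j a : U z -> jac F z a j = ('D_(ebasis R j) F z) a 0.
Proof.
move=> Uz; rewrite -(jacE _ (smooth_differentiable sF Uz)).
by rewrite /ebasis -colE [RHS]mxE.
Qed.

Lemma jac_derive : differentiable (jac F) y /\
  forall i, 'D_(ebasis R i) (jac F) y = \matrix_(a, j) H i j a.
Proof.
pose Lf z : 'M[R]_(1 + 1, d) := \matrix_(a, j) ('D_(ebasis R j) F z) a 0.
have E z : U z -> Lf z = jac F z.
  by move=> Uz; apply/matrixP => a j; rewrite mxE jac_col.
have dD j := smooth_differentiable (smooth_derive (ebasis R j) sF) Uy.
have Ee a j : (fun z => Lf z a j : R^o) = (fun z => ('D_(ebasis R j) F z) a 0 : R^o).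
  by apply/funext => z; rewrite mxE.
have dLf : differentiable Lf y.
  by apply: differentiable_mx => a j; rewrite Ee; exact: differentiable_entry (dD j).
split; first by apply: near_eq_differentiable dLf; exact: (open_near oU Uy E).
move=> i; rewrite -(derive_near_eq _ oU Uy E); apply/matrixP => a j.
by rewrite (derive_entry _ a j dLf) Ee mxE -(derive_entry _ a 0 (dD j)).
Qed.

(** Covariant derivative of the Cauchy-Riemann equation [FJ]. *)
Lemma tension_holo i : J0 R 1 *m N i = N i *m Jc y + L *m A (ebasis R i).
Proof.
have [dL DL] := jac_derive.
have E : \matrix_(a, j) H i j a *m Jc y + L *m 'D_(ebasis R i) Jc y =
    J0 R 1 *m \matrix_(a, j) H i j a.
  rewrite -DL -(derive_mulmx _ dL dJ) (derive_near_eq _ oU Uy FJ).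
  apply: (derive_linear (L := (mulmx (J0 R 1) : {linear 'M[R]_(1+1, d) -> 'M[R]_(1+1, d)}))).
    exact: linear_mx_continuous.
  exact: dL.
rewrite /N mulmxBr -E mulmxBl /A /cov_J /Ga connection_mx_basis !mulmxDr mulmxN.
rewrite !mulmxA -(FJ Uy) -/L.
have abel (p q r s : 'M[R]_(1 + 1, d)) : p + q - r = p - s + (q + (s - r)).
  by rewrite [q + (s - r)]addrCA -[RHS]addrA addKr addrA.
exact: abel.
Qed.

(** By the chain rule, the Laplacian of [phi \o F] is the contraction of the
Hessian of [phi] with [L G^-1 L^T], a multiple of the flat Laplacian by
[horizontally_conformal], plus the derivative of [phi] along the tension field
of [F], which is 0 by [tension_eq0]. *)
Lemma chart_laplacian : flat_laplacian phi (F y) = 0 ->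
  metric_laplacian G (phi \o F) y = 0.
Proof.
move=> flat.
have T := @tension_eq0 R d (G y) (Jc y) L (symG Uy) posG (JJ Uy) (JGJ Uy)
  (FJ Uy) surF A cov_J_linear cov_J_anti cov_J_skew kerA holA N tension_sym
  tension_holo.
have KE := @horizontally_conformal R d (G y) (Jc y) L (symG Uy) posG (JJ Uy) (JGJ Uy)
  (FJ Uy).
have Lcol j a : ('D_(ebasis R j) F y) a 0 = L a j by rewrite -jac_col.
pose P a := 'D_(ebasis R a) phi (F y).
pose Q b a := 'D_(ebasis R b) ('D_(ebasis R a) phi) (F y).
have step i j : 'D_(ebasis R i) ('D_(ebasis R j) (phi \o F)) y -
     \sum_(k < d) levi_civita G y k i j * 'D_(ebasis R k) (phi \o F) y =
   \sum_a (N i a j * P a + \sum_b L b i * L a j * Q b a).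
  rewrite (derive_comp2 oU Uy FU sF sphi i j).
  have -> : \sum_k levi_civita G y k i j * 'D_(ebasis R k) (phi \o F) y =
      \sum_a (\sum_k L a k * levi_civita G y k i j) * P a.
    under eq_bigr => k _ do rewrite (derive_comp1 FU sF sphi k Uy) mulr_sumr.
    rewrite exchange_big /=; apply: eq_bigr => a _; rewrite mulr_suml.
    by apply: eq_bigr => k _; rewrite Lcol mulrA [levi_civita _ _ _ _ _ * _]mulrC.
  rewrite -sumrB; apply: eq_bigr => a _; rewrite addrAC.
  congr (_ + _); first by rewrite tension_entry mulrBl.
  rewrite mulr_sumr; apply: eq_bigr => b _; rewrite !Lcol.
  by rewrite mulrA [L a j * _]mulrC.
have -> : metric_laplacian G (phi \o F) y = \sum_i \sum_j invmx (G y) i j *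
    \sum_a (N i a j * P a + \sum_b L b i * L a j * Q b a).
  by apply: eq_bigr => i _; apply: eq_bigr => j _; rewrite step.
rewrite contract_bilinear; under eq_bigr => a _ do rewrite T mul0r add0r.
have KEba b a : \sum_i \sum_j invmx (G y) i j * (L b i * L a j) =
    (L *m invmx (G y) *m L^T) b a.
  rewrite exchange_big [RHS]mxE; apply: eq_bigr => j _.
  rewrite [(L *m _) b j]mxE mulr_suml [L^T _ _]mxE; apply: eq_bigr => i _.
  by rewrite mulrA [_ * L b i]mulrC.
under eq_bigr => a _ do under eq_bigr => b _ do rewrite KEba.
exact: (@trace_scalar2 R _ _ Q KE flat).
Qed.

End ChartTension.

(** * Complex coordinates on a product *)

Section Exchange.
Variable R : realType.

(** Exchanges the two middle blocks of a vector: it identifies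
[(R^n + i R^n) x (R^p + i R^p)] with [R^(n+p) + i R^(n+p)]. *)
Definition exchange_mx m1 m2 m3 m4 : 'M[R]_((m1 + m3) + (m2 + m4), (m1 + m2) + (m3 + m4)) :=
  col_mx (block_mx (row_mx 1%:M 0) 0 0 (row_mx 1%:M 0))
         (block_mx (row_mx 0 1%:M) 0 0 (row_mx 0 1%:M)).

Lemma exchange_mxE m1 m2 m3 m4 (a : 'cV[R]_m1) (b : 'cV[R]_m2) (c : 'cV[R]_m3)
    (d : 'cV[R]_m4) :
  exchange_mx m1 m2 m3 m4 *m col_mx (col_mx a b) (col_mx c d) =
  col_mx (col_mx a c) (col_mx b d).
Proof.
rewrite /exchange_mx mul_col_mx !mul_block_col !mul_row_col.
by rewrite !mul1mx !mul0mx !addr0 !add0r.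
Qed.

Lemma exchange_mxK m1 m2 m3 m4 :
  exchange_mx m1 m3 m2 m4 *m exchange_mx m1 m2 m3 m4 = 1%:M.
Proof.
apply: mulmx_cV_inj => v; rewrite -mulmxA mul1mx -[v]vsubmxK.
by rewrite -[usubmx v]vsubmxK -[dsubmx v]vsubmxK !exchange_mxE.
Qed.

Lemma J0_col n (a b : 'cV[R]_n) : J0 R n *m col_mx a b = col_mx (- b) a.
Proof. by rewrite /J0 mul_block_col !mul0mx mulNmx !mul1mx add0r addr0. Qed.

Lemma prodJ_col n p (a : 'cV[R]_(n + n)) (b : 'cV[R]_(p + p)) :
  prodJ R n p *m col_mx a b = col_mx (J0 R n *m a) (J0 R p *m b).
Proof. by rewrite /prodJ mul_block_col !mul0mx add0r addr0. Qed.

Lemma exchange_prodJ n p :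
  exchange_mx n n p p *m prodJ R n p = J0 R (n + p) *m exchange_mx n n p p.
Proof.
apply: mulmx_cV_inj => v; rewrite -!mulmxA -[v]vsubmxK.
rewrite -[usubmx v]vsubmxK -[dsubmx v]vsubmxK.
by rewrite prodJ_col !J0_col !exchange_mxE J0_col opp_col_mx.
Qed.

End Exchange.

(** * The bundle of endomorphisms *)

Section EndBundle.
Variables (R : realType) (d : nat) (T : Type) (A : atlas R d T).
Variable g : T -> 'M[R]_d.

Lemma end_covering : covering A -> covering (end_atlas A).
Proof.
move=> cA z; have [? ?] := cA z.1; split => //=.
by exists (chart_at A z.1).
Qed.

(** Horizontal part of the almost complex structure of the twistor space. *)
Lemma dpi_J1 z v : dpi (J1 A g z v) = z.2 *m dpi v.
Proof. by rewrite /dpi /J1 /hlift /vlift linearD /= !col_mxKu addr0. Qed.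

(** Vertical part: the bracket terms of the horizontal lift and of the connection
map cancel. *)
Lemma vert_J1 z v : vert A g z (J1 A g z v) = z.2 *m vert A g z v.
Proof.
rewrite {1}/vert dpi_J1 /J1 /hlift /vlift; set Gam := gamma A g z.1 _.
rewrite linearD /= !col_mxKd linearD /= !trmxK linearD /= !mxvecK.
by rewrite addrAC addrA subrK addrN add0r.
Qed.

Lemma nabla_split (L : T -> 'M[R]_d) x (X : 'cV[R]_d) :
  nabla A g L x X =
  vert A g (x, L x) (mdiff A (end_atlas A) (fun y => (y, L y)) x *m X).
Proof. by []. Qed.

End EndBundle.

Section DpiMdiff.
Variables (R : realType) (d e : nat) (S T : Type).
Variables (B : atlas R e S) (A : atlas R d T).
Hypotheses (rB : regular B) (rA : regular A).
Variables (W : set S) (H : S -> T * 'M[R]_d).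
Hypothesis sH : smooth_map B (end_atlas A) W H.

Lemma dpi_mdiff w v : W w ->
  dpi (mdiff B (end_atlas A) H w *m v) = mdiff B A (fun w => (H w).1) w *m v.
Proof.
move=> Ww; have [cA _ _] := rA.
have dH := mdiff_diff rB (end_covering cA) sH Ww.
apply: etrans (esym (jac_lin_comp usubmx v dH)) _.
apply: (congr1 (fun F => jac F _ *m v)).
by apply/funext => y; rewrite /in_charts /= col_mxKu.
Qed.

End DpiMdiff.

(** * Pulled-back functions and straight lines *)

Section SmoothFun.
Variables (R : realType) (d e : nat) (S T : Type).
Variables (A : atlas R d S) (B : atlas R e T).
Hypotheses (rA : regular A) (rB : regular B).

Lemma smooth_fun_comp W V (f : S -> T) (u : T -> R) :
  smooth_map A B W f -> chart_open B V -> smooth_fun B V u ->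
  smooth_fun A (W `&` f @^-1` V) (u \o f).
Proof.
have [cA iA _] := rA; have [cB iB _] := rB.
move=> sf oV su c cc; apply: smooth_local => _ [x [[Wx Vx] cx] <-].
have [cc' cfx] := cB (f x).
have oO := chart_openI rB oV (chart_open_cdom rB cc').
have oU := smooth_map_chart_open rA rB sf oO cc.
set U := (X in open X) in oU; exists U; split; first by exists x.
have [_ sF] := sf c _ cc cc'; have sphi := su _ cc'.
apply: (@smooth_ext R _ _ U ((u \o cinv (chart_at B (f x))) \o
   in_charts c (chart_at B (f x)) f) _ oU).
  move=> _ [y [[Wy [Vy cy']] cy] <-]; rewrite /in_charts /= (iA c cc y cy).
  by rewrite (iB _ cc' _ cy').
apply: (smooth_comp oU _ _ sphi).
  move=> _ [y [[Wy [Vy cy']] cy] <-]; rewrite /in_charts /= (iA c cc y cy).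
  by exists (f y).
apply: smooth_sub sF => _ [y [[Wy [Vy cy']] cy] <-].
by exists y.
Qed.

End SmoothFun.

Section Curves.
Variables (R : realType) (d : nat).

Lemma line_open (a v : 'cV[R]_d) (U : set 'cV[R]_d) : open U -> U a ->
  exists2 eps : R, 0 < eps & forall t : R, `|t| < eps -> U (a + t *: v).
Proof.
move=> oU Ua.
have [e e0 He] := near_square v (- v) (open_nbhs_nbhs (conj oU Ua)).
exists e => // t te; have z0 : 0 <= (0 : R) <= e by rewrite lexx ltW.
have [t0|t0] := leP 0 t.
  have te' : 0 <= t <= e by rewrite t0 -(ger0_norm t0) ltW.
  by have := He t 0 te' z0; rewrite scale0r addr0.
have te' : 0 <= - t <= e by rewrite oppr_ge0 -(ltr0_norm t0) !ltW.
by have := He 0 (- t) z0 te'; rewrite scale0r addr0 scalerN scaleNr opprK.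
Qed.

Lemma smooth_line (U : set R^o) (a v : 'cV[R]_d) : open U ->
  smooth_on U (fun t : R^o => a + t *: v).
Proof.
move=> oU; apply: (smoothD oU (smooth_cst _ _)) => k.
apply: (@CkZ R _ _ k U id (cst v) oU); last exact: Ck_cst.
case: k => [|k] /=; first by move=> x _; exact: cvg_id.
split=> [x _|w]; first exact: (@ex_diff _ _ _ _ _ _ _ (is_diff_id x)).
rewrite (_ : (fun _ => _) = cst w); first exact: Ck_cst.
by apply/funext => x; rewrite derive_id.
Qed.

Lemma derive_line (e : nat) (f : 'cV[R]_d -> 'cV[R]_e) a v : differentiable f a ->
  derive1 (fun t : R => f (a + t *: v)) 0 = jac f a *m v.
Proof.
move=> df; have E : a + 0 *: v = a by rewrite scale0r addr0.
have df0 : differentiable f (a + 0 *: v) by rewrite E.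
rewrite derive1E; have [_ D] := line_derive df0; apply: etrans D _.
by rewrite (jacE v df) E.
Qed.

End Curves.

Section LaplacianExt.
Variables (R : realType) (d : nat).

Lemma metric_laplacian_ext (G : 'cV[R]_d -> 'M[R]_d) (u v : 'cV[R]_d -> R^o)
   (U : set 'cV[R]_d) y : open U -> U y -> (forall z, U z -> u z = v z) ->
  metric_laplacian G u y = metric_laplacian G v y.
Proof.
move=> oU Uy uv.
have D1 z k : U z -> 'D_(ebasis R k) u z = 'D_(ebasis R k) v z.
  by move=> Uz; exact: (derive_near_eq _ oU Uz uv).
apply: eq_bigr => i _; apply: eq_bigr => j _.
apply: (congr2 (fun p q : R => invmx (G y) i j * (p - q))).
  by apply: (derive_near_eq _ oU Uy) => z Uz; exact: D1.
by apply: eq_bigr => k _; rewrite (D1 y k Uy).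
Qed.

End LaplacianExt.

(** * The projection defined by a holomorphic map into the twistor space *)

Section Twistor.
Variables (R : realType) (n p : nat) (N P M : topologicalType).
Variables (AN : atlas R (n + n) N) (AP : atlas R (p + p) P).
Variables (AM : atlas R ((n + p) + (n + p)) M).
Variables (g : M -> 'M[R]_((n + p) + (n + p))).
Variables (W : set (N * P)) (H : N * P -> M * 'M[R]_((n + p) + (n + p))).
Variable (hinv : M -> N * P).
Hypotheses (cN : complex_manifold AN) (cP : complex_manifold AP).
Hypothesis mM : is_manifold AM.
Local Notation AB := (prod_atlas AN AP).
Local Notation AE := (end_atlas AM).
Local Notation TM := 'cV[R]_((n + p) + (n + p)).
Hypothesis hol : J1_holomorphic AM g AB (fun _ v => prodJ R n p *m v) W H.
Hypothesis hor : forall z : N,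
  horizontal_map AM g AP [set xi | W (z, xi)] (fun xi => H (z, xi)).
Let h : N * P -> M := fun w => (H w).1.
Hypothesis dif : diffeo_onto_image AB AM W h hinv.
Let hW : set M := h @` W.
Let J : M -> 'M[R]_((n + p) + (n + p)) := fun x => (H (hinv x)).2.
Let f : M -> N := fun x => (hinv x).1.

Let rN : regular AN. Proof. by case: cN => /manifold_regular. Qed.
Let rP : regular AP. Proof. by case: cP => /manifold_regular. Qed.
Let rM : regular AM. Proof. exact: manifold_regular. Qed.
Let rB : regular AB. Proof. exact: regular_prod. Qed.
Let covN : covering AN. Proof. by case: rN. Qed.
Let covP : covering AP. Proof. by case: rP. Qed.
Let covM : covering AM. Proof. by case: rM. Qed.
Let covB : covering AB. Proof. by case: rB. Qed.
Let covE : covering AE. Proof. exact: end_covering. Qed.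
Let sH : smooth_map AB AE W H. Proof. by case: hol => _ []. Qed.
Let sh : smooth_map AB AM W h. Proof. by case: dif. Qed.
Let si : smooth_map AM AB hW hinv. Proof. by case: dif. Qed.
Let hK w : W w -> hinv (h w) = w. Proof. by case: dif => _ _ _; apply. Qed.
Let iW x : hW x -> W (hinv x).
Proof. by move=> [w Ww <-]; rewrite hK. Qed.
Let iK x : hW x -> h (hinv x) = x.
Proof. by move=> [w Ww <-]; rewrite hK. Qed.
Let oW : chart_open AB W. Proof. exact: (smooth_map_open rB rM sh). Qed.
Let ohW : chart_open AM hW. Proof. exact: (smooth_map_open rM rB si). Qed.

Local Notation Dh w := (mdiff AB AM h w).
Local Notation Di x := (mdiff AM AB hinv x).

Let Dih x : hW x -> Dh (hinv x) *m Di x = 1%:M.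
Proof.
move=> hx; rewrite -(mdiff_comp rM rB si sh covM hx (iW hx)) -(mdiff_id rM x).
apply: esym; apply: (mdiff_ext rM covM ohW hx) => [y /iK //|].
by have [_ _ +] := rM; apply: smooth_map_sub.
Qed.

Let Dhi w : W w -> Di (h w) *m Dh w = 1%:M.
Proof.
move=> Ww; have hw : hW (h w) by exists w.
rewrite -(mdiff_comp rB rM sh si covB Ww hw) -(mdiff_id rB w).
apply: esym; apply: (mdiff_ext rB covB oW Ww) => [y /hK //|].
by have [_ _ +] := rB; apply: smooth_map_sub.
Qed.

(** The horizontal part of the holomorphy of [H]: the map [h] is holomorphic. *)
Let DhJ w (v : 'cV[R]_((n + n) + (p + p))) : W w ->
  Dh w *m (prodJ R n p *m v) = (H w).2 *m (Dh w *m v).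
Proof.
move=> Ww; have [_ [_ /(_ w v Ww) E]] := hol.
rewrite -(dpi_mdiff rB rM sH _ Ww) E dpi_J1.
by rewrite (dpi_mdiff rB rM sH _ Ww).
Qed.

Let DiJ x (v : TM) : hW x ->
  Di x *m (J x *m v) = prodJ R n p *m (Di x *m v).
Proof.
move=> hx; rewrite -[v in LHS]mul1mx -(Dih hx) -mulmxA -(DhJ _ (iW hx)).
by rewrite mulmxA -[X in Di X *m _](iK hx) Dhi ?mul1mx //; exact: iW.
Qed.

Let smf : smooth_map AM AN hW f.
Proof. by apply: (smooth_map_comp rM rB si (smooth_fst rN rP)). Qed.

Let Df x (v : TM) : hW x ->
  mdiff AM AN f x *m v = usubmx (Di x *m v).
Proof.
move=> hx; rewrite -(mdiff_fst rN rP (hinv x)) mulmxA; congr (_ *m v).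
exact: (mdiff_comp rM rB si (smooth_fst rN rP) covN hx I).
Qed.

Lemma projection_holomorphic :
  holomorphic AM AN (fun x v => J x *m v) (fun _ v => J0 R n *m v) hW f.
Proof.
split=> // x v hx; rewrite (Df _ hx) (DiJ _ hx) -[Di x *m v]vsubmxK.
by rewrite prodJ_col col_mxKu (Df _ hx).
Qed.

Let sg x := (x, J x).
Let sgE x : hW x -> H (hinv x) = sg x.
Proof. by move=> hx; rewrite /sg /J -[X in (X, _)](iK hx) -surjective_pairing. Qed.

Lemma section_smooth : smooth_map AM AE hW sg.
Proof.
apply: (smooth_map_ext rM sgE).
by apply: (smooth_map_comp rM rB si sH) => x /iW.
Qed.

Let Dsg x : hW x -> mdiff AM AE sg x = mdiff AB AE H (hinv x) *m Di x.
Proof.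
move=> hx; rewrite -(mdiff_comp rM rB si sH covE hx (iW hx)).
apply: esym; apply: (mdiff_ext rM covE ohW hx sgE).
by apply: (smooth_map_comp rM rB si sH) => y /iW.
Qed.

(** The vertical part of the holomorphy of the section [H \o hinv], whose
covariant derivative is [nabla AM g J]. *)
Lemma nabla_holomorphic x (X : TM) : hW x ->
  nabla AM g J x (J x *m X) = J x *m nabla AM g J x X.
Proof.
move=> hx; rewrite !nabla_split -/sg (Dsg hx) -!mulmxA (DiJ _ hx).
have [_ [_ E]] := hol.
by rewrite (E _ _ (iW hx)) (sgE hx) vert_J1.
Qed.

Let kernel_vertical x (X : TM) : hW x ->
  mdiff AM AN f x *m X = 0 ->
  Di x *m X = col_mx 0 (dsubmx (Di x *m X)).
Proof. by move=> hx; rewrite (Df _ hx) => E; rewrite -{1}[Di x *m X]vsubmxK E. Qed.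

(** A vector killed by [f] is the image under [h] of a vector tangent to a slice
[{z} x P], along which the section is the horizontal map [H (z, -)]. *)
Lemma nabla_vertical x (X : TM) : hW x ->
  mdiff AM AN f x *m X = 0 ->
  nabla AM g J x X = 0.
Proof.
move=> hx /(kernel_vertical hx) E; rewrite nabla_split -/sg (Dsg hx) -mulmxA E.
have hv := @hor (hinv x).1 (hinv x).2 (dsubmx (Di x *m X)).
rewrite /horizontal_space /= -surjective_pairing in hv.
rewrite -[(x, J x)]/(sg x) -(sgE hx) -(mdiff_pair rN rP (hinv x).1 (hinv x).2).
have sp := @smooth_pair _ _ _ _ _ AN AP rP (hinv x).1.
have ep : ((hinv x).1, (hinv x).2) = hinv x by rewrite -surjective_pairing.
have Wp : W ((hinv x).1, (hinv x).2) by rewrite ep; exact: iW.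
have C := mdiff_comp rP rB sp sH covE I Wp.
rewrite ep in C; rewrite mulmxA -C; apply: hv.
exact: iW.
Qed.

Lemma section_almost_complex x : hW x -> J x *m J x = - 1%:M /\ orthogonal_at g x (J x).
Proof.
move=> hx; have [/(_ _ (iW hx)) [/= O JJ _] _] := hol; split => //.
by have := O; rewrite -[(H _).1]/(h (hinv x)) (iK hx).
Qed.

Let f_section x : hW x ->
  mdiff AM AN f x *m (Dh (hinv x) *m col_mx 1%:M 0) = 1%:M.
Proof.
move=> hx; apply: mulmx_cV_inj => v; rewrite -mulmxA (Df _ hx) -mulmxA.
rewrite -{1}(iK hx) mulmxA (Dhi (iW hx)) mul1mx mul_col_mx mul1mx mul0mx.
by rewrite col_mxKu.
Qed.

(** The defining submersion is [f] read in a chart around [z]; composing its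
differential with that of [h] gives the projection of the product, so that the
rank is full. *)
Lemma fibre_submanifold z : submanifold AM (n + n) (hW `&` f @^-1` [set z]).
Proof.
move=> x [hx fx]; have [cc cz] := covN z; set c := chart_at AN z in cc cz.
have [_ iN _] := rN; have [_ iM _] := rM.
pose V := hW `&` f @^-1` cdom c; pose s y := cmap c (f y) - cmap c z.
have oV : chart_open AM V.
  exact: (smooth_map_chart_open rM rN smf (chart_open_cdom rN cc)).
have sV : smooth_map AM AN V f by apply: (smooth_map_sub rM _ oV smf) => y [].
have sVc : smooth_map AM (euclid R (n + n)) V (cmap c \o f).
  by apply: (smooth_map_comp rM rN sV (smooth_cmap rN cc)) => y [].
have st : smooth_on setT (fun u : 'cV[R]_(n + n) => u + - cmap c z).
  apply: (smoothD openT); first exact: (smooth_lin setT idfun).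
  exact: (@smooth_cst R _ _ _ (- cmap c z)).
have ste := smooth_map_euclid openT st.
have rE := regular_euclid R (n + n).
exists V, s; split.
- exact: (chart_open_open mM oV).
- by split=> //; rewrite /preimage /= fx.
- by apply: (smooth_map_comp rM rE sVc ste).
- move=> y Vy; have [hy cy] := Vy.
  have covEu : covering (euclid R (n + n)) by case: rE.
  have [ccy cyy] := covN (f y).
  have E := mdiff_comp rM rE sVc ste covEu Vy I.
  have E2 := mdiff_comp rM rN sV (smooth_cmap rN cc) covEu Vy cy.
  have E3 : mdiff (euclid R (n + n)) (euclid R (n + n))
     (fun u : 'cV[R]_(n + n) => u + - cmap c z) (cmap c (f y)) = 1%:M.
    apply: mulmx_cV_inj => v; rewrite mul1mx.
    have dst := smooth_differentiable st (I : setT (cmap c (f y))).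
    apply: etrans (jacE v dst) _.
    have [_ ->] := @shift_derive R _ _ id (- cmap c z) (cmap c (f y)) v
      (@ex_diff _ _ _ _ _ _ _ (is_diff_id _)).
    by rewrite derive_id.
  have -> : mdiff AM (euclid R (n + n)) s y =
     transition (chart_at AN (f y)) c (f y) *m mdiff AM AN f y.
    apply: etrans E _; rewrite E2; apply: etrans (congr1 (mulmx^~ _) E3) _.
    by rewrite mul1mx.
  apply/eqP; apply/row_freeP.
  exists (Dh (hinv y) *m col_mx 1%:M 0 *m invmx (transition (chart_at AN (f y)) c (f y))).
  rewrite !mulmxA -[_ *m mdiff AM AN f y *m _ *m _]mulmxA.
  rewrite -[_ *m mdiff AM AN f y *m _]mulmxA (f_section hy) mulmx1 mulmxV //.
  exact: (transition_unit rN ccy cc cyy cy).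
apply/seteqP; split=> y.
  by move=> [[hy fy] Vy]; split => //; rewrite /s fy subrr.
move=> [[hy cy] /eqP]; rewrite subr_eq0 => /eqP E; split=> //; split => //.
by rewrite /preimage /= -(iN _ cc _ cy) E iN.
Qed.

(** Differentiate the constant function [f \o gam]. *)
Lemma tangent_kernel z x (X : TM) : (hW `&` f @^-1` [set z]) x ->
  tangent_space AM (hW `&` f @^-1` [set z]) x X -> mdiff AM AN f x *m X = 0.
Proof.
move=> [hx fx] [eps [gam [e0 g0 gF sgam dgam]]]; have [_ iM _] := rM.
have [cc cx] := covM x; set c := chart_at AM x in cc cx gF sgam dgam.
have U0 : [set t : R^o | `|t| < eps] 0 by rewrite /= normr0.
have dg := smooth_differentiable sgam U0.
have E0 : (cmap c \o gam) 0 = cmap c x by rewrite /= g0.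
have dF := mdiff_diff rM covN smf hx.
rewrite -[cmap _ _]E0 in dF.
pose F := in_charts c (chart_at AN (f x)) f.
have dFg := @differentiable_comp _ _ _ _ (cmap c \o gam : R^o -> _) F (0 : R^o) dg dF.
rewrite -dgam derive1E mdiffE -E0.
apply: etrans (jacE _ dF) _; apply: etrans (deriveE _ dF) _.
rewrite (deriveE (1 : R^o) dg).
have -> : 'd F ((cmap c \o gam) 0) ('d (cmap c \o gam : R^o -> _) (0 : R^o) 1) =
   'D_1 (F \o (cmap c \o gam : R^o -> _)) (0 : R^o).
  by apply: esym; apply: etrans (deriveE (1 : R^o) dFg) _; rewrite (diff_comp dg dF).
have oU : open [set t : R^o | `|t| < eps].
  rewrite (_ : [set _ | _] = ball (0 : R^o) eps); first exact: ball_open.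
  by apply/seteqP; split=> t; rewrite -ball_normE /= sub0r normrN.
apply: etrans (derive_near_eq (g := cst (cmap (chart_at AN (f x)) z)) _ oU U0 _) _.
  move=> t /gF [[ht ft] ct]; rewrite /F /in_charts /= (iM _ cc _ ct).
  by rewrite ft.
by rewrite derive_cst.
Qed.

(** The vector is the velocity of the image under [h] of a straight line of the
slice [{z} x P], taken in a chart of [P]. *)
Lemma kernel_tangent z x (X : TM) : (hW `&` f @^-1` [set z]) x ->
  mdiff AM AN f x *m X = 0 -> tangent_space AM (hW `&` f @^-1` [set z]) x X.
Proof.
move=> [hx fx] /(kernel_vertical hx) E; have [_ iP _] := rP.
set v := dsubmx _ in E; have hix : hinv x = (z, (hinv x).2).
  by rewrite -fx -surjective_pairing.
set xi := (hinv x).2 in hix.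
have Wz : W (z, xi) by rewrite -hix; exact: iW.
have sp := @smooth_pair _ _ _ _ _ AN AP rP z.
pose Wp := [set y | W (z, y)].
have oWp : chart_open AP Wp.
  have := smooth_map_chart_open rP rB sp oW.
  by rewrite setTI.
have spW : smooth_map AP AB Wp (pair z).
  by apply: (smooth_map_sub rP _ oWp sp).
have shp : smooth_map AP AM Wp (h \o pair z).
  by apply: (smooth_map_comp rP rB spW sh).
have [cc cxi] := covP xi; set c := chart_at AP xi in cc cxi.
have [cx xx] := covM x; set c' := chart_at AM x in cx xx.
have hzx : h (z, xi) = x by rewrite -hix iK.
have [oU sU] := shp c c' cc cx; set U := (X in open X) in oU sU.
have Ux : U (cmap c xi) by exists xi => //; split => //; rewrite /preimage /= hzx.
have [eps e0 He] := line_open v oU Ux.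
pose gam t := h (z, cinv c (cmap c xi + t *: v)).
have oT : open [set t : R^o | `|t| < eps].
  rewrite (_ : [set _ | _] = ball (0 : R^o) eps); first exact: ball_open.
  by apply/seteqP; split=> t; rewrite -ball_normE /= sub0r normrN.
exists eps, gam; split => //.
- by rewrite /gam scale0r addr0 (iP _ cc _ cxi).
- move=> t /He [y [[Wy cy] hy] Ey]; rewrite /gam -Ey (iP _ cc _ cy); split => //.
  split; first by exists (z, y).
  by rewrite /preimage /= /f (hK Wy).
- by apply: (smooth_comp oT He (smooth_line _ _ oT) sU).
have dU := smooth_differentiable sU Ux.
apply: etrans (derive_line v dU) _.
have C := mdiff_comp rP rB sp sh covM I Wz.
have -> : jac ((cmap c' \o (h \o pair z)) \o cinv c) (cmap c xi) =
   mdiff AP AM (h \o pair z) xi by rewrite mdiffE /= hzx.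
rewrite C -mulmxA (mdiff_pair rN rP) -E -hix mulmxA (Dih hx) mul1mx //.
Qed.

Lemma fibre_superminimal z : superminimal AM g J (hW `&` f @^-1` [set z]).
Proof.
split.
- by exists (n + n)%N; exact: fibre_submanifold.
- move=> x X Fx TX; have [hx _] := Fx; apply: (kernel_tangent Fx).
  have [_ E] := projection_holomorphic.
  by rewrite (E _ _ hx) (tangent_kernel Fx TX) mulmx0.
move=> x X Fx TX; have [hx _] := Fx.
exact: (nabla_vertical hx (tangent_kernel Fx TX)).
Qed.

(** The coordinates are product charts of [N x P] read through [hinv]; their
transition maps are block diagonal, hence complex linear. *)
Lemma section_hermitian : hermitian_structure AM g hW J.
Proof.
split; first by split; [exact: section_smooth|exact: section_almost_complex].
move=> x hx; have [cC Cx] := covB (hinv x); set C := chart_at AB (hinv x) in cC Cx.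
have [_ iB _] := rB.
pose Qm := exchange_mx R n n p p; pose Qi := exchange_mx R n p n p.
have QiQm : Qi *m Qm = 1%:M by exact: exchange_mxK.
have QmQi : Qm *m Qi = 1%:M by exact: exchange_mxK.
pose V := hW `&` hinv @^-1` cdom C.
pose D := mulmx Qi @^-1` (cmap C @` (W `&` cdom C)).
pose phi y := Qm *m cmap C (hinv y); pose phiinv u := h (cinv C (Qi *m u)).
have oV : chart_open AM V.
  exact: (smooth_map_chart_open rM rB si (chart_open_cdom rB cC)).
have siV : smooth_map AM AB V hinv by apply: (smooth_map_sub rM _ oV si) => y [].
pose eu := euclid R ((n + n) + (p + p)); pose eu' := euclid R ((n + p) + (n + p)).
have rE : regular eu := regular_euclid R _.
have rE' : regular eu' := regular_euclid R _.
have covEu : covering eu by case: rE.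
have covEu' : covering eu' by case: rE'.
have s1 : smooth_map AM eu V (cmap C \o hinv).
  by apply: (smooth_map_comp rM rB siV (smooth_cmap rB cC)) => y [].
have sQ : smooth_map eu eu' setT (mulmx Qm).
  exact: (smooth_map_euclid openT (smooth_lin setT (mulmx Qm))).
have sphi : smooth_map AM eu' V phi by apply: (smooth_map_comp rM rE s1 sQ).
have oD : open D by exact: (open_lin_preim (L := mulmx Qi) (oW cC)).
have sQi : smooth_map eu' eu D (mulmx Qi).
  exact: (smooth_map_euclid oD (smooth_lin D (mulmx Qi))).
have s2 : smooth_map eu' AB D (cinv C \o mulmx Qi).
  apply: (smooth_map_comp rE' rE sQi (smooth_cinv rB cC)) => u [w [_ Cw] E].
  by exists w.
have sphii : smooth_map eu' AM D phiinv.
  apply: (smooth_map_comp rE' rB s2 sh) => u [w [Ww Cw] E].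
  have -> // : (cinv C \o mulmx Qi) u = w.
  exact: etrans (congr1 (cinv C) (esym E)) (iB _ cC _ Cw).
have phiV : phi @` V = D.
  apply/seteqP; split=> u.
    move=> [y [hy Cy] <-]; exists (hinv y); first by split => //; exact: iW.
    by rewrite /phi mulmxA QiQm mul1mx.
  move=> [w [Ww Cw] E]; exists (h w).
    by split; [exists w|rewrite /preimage /= (hK Ww)].
  by rewrite /phi (hK Ww) E mulmxA QmQi mul1mx.
exists V, phi, phiinv; split.
- exact: (chart_open_open mM oV).
- by [].
- by move=> y [].
- split => //; rewrite ?phiV // => y [hy Cy].
  by rewrite /phiinv /phi mulmxA QiQm mul1mx (iB _ cC _ Cy) iK.
split => // y v [hy Cy]; have [ca ya] := covB (hinv y).
have Vy : V y by [].
have E1 := mdiff_comp rM rE s1 sQ covEu' Vy I.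
have E2 := mdiff_comp rM rB siV (smooth_cmap rB cC) covEu Vy Cy.
have E3 (w : TM) : mdiff AM eu' phi y *m w =
    Qm *m (transition (chart_at AB (hinv y)) C (hinv y) *m (Di y *m w)).
  apply: etrans (congr1 (mulmx^~ w) E1) _; rewrite E2 -!mulmxA.
  exact: (jac_lin (mulmx Qm)).
rewrite !E3 (DiJ _ hy).
have TJ : transition (chart_at AB (hinv y)) C (hinv y) *m prodJ R n p =
    prodJ R n p *m transition (chart_at AB (hinv y)) C (hinv y).
  have [ca1 ya1] := covN (hinv y).1; have [ca2 ya2] := covP (hinv y).2.
  have [cb1 _] := covN (hinv x).1; have [cb2 _] := covP (hinv x).2.
  have [Cy1 Cy2] := Cy.
  have -> := transition_prod rN rP ca1 ca2 cb1 cb2 (conj ya1 ya2) Cy.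
  have [_ /(_ _ _ _ ca1 cb1 ya1 Cy1) F1] := cN.
  have [_ /(_ _ _ _ ca2 cb2 ya2 Cy2) F2] := cP.
  by rewrite /prodJ !mulmx_block !mul0mx !mulmx0 !addr0 !add0r F1 F2.
rewrite [transition _ _ _ *m (prodJ _ _ _ *m _)]mulmxA TJ !mulmxA.
by rewrite /Qm exchange_prodJ.
Qed.

Lemma projection_submersive x : hW x -> exists S0, mdiff AM AN f x *m S0 = 1%:M.
Proof. by move=> hx; exists (Dh (hinv x) *m col_mx 1%:M 0); exact: f_section. Qed.

End Twistor.

(** * Harmonic morphisms onto a surface *)

Section MetricIn.
Variables (R : realType) (d : nat) (T : Type) (A : atlas R d T).
Variable g : T -> 'M[R]_d.
Hypotheses (rA : regular A) (rg : riemannian_metric A g).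
Variable c : chart R d T.
Hypothesis cc : charts A c.

Lemma metric_in_cmap x : cdom c x ->
  metric_in A g c (cmap c x) =
  (transition c (chart_at A x) x)^T *m g x *m transition c (chart_at A x) x.
Proof. by have [_ iA _] := rA; move=> cx; rewrite /metric_in (iA c cc x cx). Qed.

Lemma metric_in_sym y : (cmap c @` cdom c) y -> (metric_in A g c y)^T = metric_in A g c y.
Proof.
have [sg _ _] := rg; move=> [x cx <-]; rewrite metric_in_cmap //.
by rewrite !trmx_mul trmxK sg mulmxA.
Qed.

Lemma metric_in_pos y (v : 'cV[R]_d) : (cmap c @` cdom c) y -> v != 0 ->
  0 < (v^T *m metric_in A g c y *m v) 0 0.
Proof.
have [_ pg _] := rg; have [cA _ _] := rA; move=> [x cx <-] v0.
have [ca xa] := cA x; rewrite metric_in_cmap //.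
set D := transition _ _ _; have uD : D \in unitmx by exact: (transition_unit rA cc ca cx xa).
have Dv0 : D *m v != 0.
  apply: contra v0 => /eqP Dv; rewrite -[v]mul1mx -(mulVmx uD) -mulmxA Dv.
  by rewrite mulmx0.
by have := pg x _ Dv0; rewrite trmx_mul !mulmxA.
Qed.

Lemma metric_in_differentiable y : (cmap c @` cdom c) y ->
  differentiable (metric_in A g c) y.
Proof.
by have [_ _ sg] := rg; move=> cy; exact: smooth_differentiable (sg c cc) cy.
Qed.

End MetricIn.

Section EndCoord.
Variables (R : realType) (d : nat).

(** The fibre coordinate of a chart of the bundle of endomorphisms. *)
Definition end_coord : 'cV[R]_(d + d * d) -> 'M[R]_d := vec_mx \o trmx \o dsubmx.

Fact end_coord_is_linear : linear end_coord.
Proof. by move=> a u v; rewrite /end_coord /= !linearP. Qed.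
HB.instance Definition _ := GRing.isLinear.Build R 'cV[R]_(d + d * d) 'M[R]_d _
  end_coord end_coord_is_linear.

End EndCoord.

Section HarmonicMorphism.
Variables (R : realType) (d : nat) (N M : topologicalType).
Variables (AN : atlas R (1 + 1) N) (AM : atlas R d M).
Variables (g : M -> 'M[R]_d) (U : set M) (J : M -> 'M[R]_d) (f : M -> N).
Hypotheses (cN : complex_manifold AN) (rM : regular AM).
Hypothesis rg : riemannian_metric AM g.
Hypotheses (smf : smooth_map AM AN U f) (aJ : almost_hermitian AM g U J).
Hypothesis fJ : forall x (v : 'cV[R]_d), U x ->
  mdiff AM AN f x *m (J x *m v) = J0 R 1 *m (mdiff AM AN f x *m v).
Hypothesis surf : forall x, U x -> exists S0, mdiff AM AN f x *m S0 = 1%:M.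
Hypothesis kerJ : forall x (X : 'cV[R]_d), U x ->
  mdiff AM AN f x *m X = 0 -> nabla AM g J x X = 0.
Hypothesis holJ : forall x (X : 'cV[R]_d), U x ->
  nabla AM g J x (J x *m X) = J x *m nabla AM g J x X.

Let rN : regular AN. Proof. by case: cN => /manifold_regular. Qed.
Let covM : covering AM. Proof. by case: rM. Qed.
Let covN : covering AN. Proof. by case: rN. Qed.
Let iM : chart_inverse AM. Proof. by case: rM. Qed.
Let iN : chart_inverse AN. Proof. by case: rN. Qed.
Let sgJ : smooth_map AM (end_atlas AM) U (fun x => (x, J x)). Proof. by case: aJ. Qed.
Let covE : covering (end_atlas AM). Proof. exact: end_covering. Qed.

(** The matrix of [J] in the frame of a fixed chart. *)
Definition J_in (c : chart R d M) (z : 'cV[R]_d) : 'M[R]_d :=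
  end_coord (in_charts c (end_chart AM c) (fun x => (x, J x)) z).

Lemma J_in_differentiable x : U x ->
  differentiable (J_in (chart_at AM x)) (cmap (chart_at AM x) x).
Proof.
move=> Ux; have dE := mdiff_diff rM covE sgJ Ux.
exact: differentiable_comp dE (linear_mx_differentiable (@end_coord R d) _).
Qed.

Lemma J_in_cmap c x : charts AM c -> cdom c x ->
  J_in c (cmap c x) = invmx (transition c (chart_at AM x) x) *m J x *m
                      transition c (chart_at AM x) x.
Proof.
by move=> cc cx; rewrite /J_in /end_coord /in_charts /= (iM cc cx) col_mxKd trmxK mxvecK.
Qed.

(** Since [c] is the preferred chart at [x], its frame at [x] is the reference
frame of [T_x]. *)
Lemma nabla_chart x X : U x -> let c := chart_at AM x in
  nabla AM g J x X = cov_J (cmap c x) (metric_in AM g c) (J_in c) X.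
Proof.
move=> Ux c; have [cc cx] := covM x.
have dE := mdiff_diff rM covE sgJ Ux.
have EJ : J_in c (cmap c x) = J x.
  by rewrite (J_in_cmap cc cx) (transition_refl rM cc cx) invmx1 mul1mx mulmx1.
rewrite nabla_split /vert /=.
have -> : dpi (mdiff AM (end_atlas AM) (fun y => (y, J y)) x *m X) = X.
  apply: etrans (dpi_mdiff rM rM sgJ X Ux) _.
  by rewrite -[RHS]mul1mx -(mdiff_id rM x).
rewrite /cov_J EJ; congr (_ + _).
have cL : continuous (@end_coord R d) by exact: linear_mx_continuous.
apply: etrans (congr1 (@end_coord R d) (jacE X dE)) _.
exact: esym (derive_linear X cL dE).
Qed.

Variable k : N -> 'M[R]_(1 + 1).
Hypotheses (rk : riemannian_metric AN k) (ok : forall z, orthogonal_at k z (J0 R 1)).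

Lemma metric_in_conformal c z : charts AN c -> (cmap c @` cdom c) z ->
  (J0 R 1)^T *m metric_in AN k c z *m J0 R 1 = metric_in AN k c z.
Proof.
move=> cc [x cx <-]; rewrite (metric_in_cmap k rN cc cx).
have [ca xa] := covN x; have [_ /(_ _ _ _ cc ca cx xa) E] := cN.
set D := transition _ _ _ in E *.
transitivity ((D *m J0 R 1)^T *m k x *m (D *m J0 R 1)).
  by rewrite trmx_mul !mulmxA.
rewrite E trmx_mul.
transitivity (D^T *m ((J0 R 1)^T *m k x *m J0 R 1) *m D); first by rewrite !mulmxA.
by rewrite ok.
Qed.

(** Read all the data in the preferred charts [c] at [x] and [c'] at [f x].
Harmonicity of [u] gives that of [u] for the flat metric
([conformal_laplacian]), and [chart_laplacian] transports it. *)
Lemma harmonic_pullback (V : set N) u : open V -> harmonic_on AN k V u ->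
  harmonic_on AM g (U `&` f @^-1` V) (u \o f).
Proof.
move=> oV [su hu]; have mN : is_manifold AN by case: cN.
have oVc := open_chart_open mN oV.
split; first exact: (smooth_fun_comp rM rN smf oVc su).
move=> x [Ux Vx]; have [cc cx] := covM x; have [cc' cfx] := covN (f x).
set c := chart_at AM x in cc cx; set c' := chart_at AN (f x) in cc' cfx.
have oO := chart_openI rN oVc (chart_open_cdom rN cc').
have oD := smooth_map_chart_open rM rN smf oO cc.
set D := (X in open X) in oD.
have Dx : D (cmap c x) by exists x.
have [_ sF] := smf cc cc'.
pose F := in_charts c c' f; pose phi : 'cV[R]_(1 + 1) -> R^o := u \o cinv c'.
pose D' := cmap c' @` (V `&` cdom c').
have sphi : smooth_on D' phi := su _ cc'.
have FD z : D z -> D' (F z).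
  move=> [y [[Uy [Vy cy']] cy] <-]; exists (f y) => //.
  by rewrite /F /in_charts /= (iM cc cy).
have sFD : smooth_on D F.
  by apply: smooth_sub sF => _ [y [[Uy [Vy cy']] cy] <-]; exists y.
have DcM z : D z -> (cmap c @` cdom c) z by move=> [y [_ cy] <-]; exists y.
have Fx : F (cmap c x) = cmap c' (f x) by rewrite /F /in_charts /= (iM cc cx).
pose G := metric_in AM g c.
have dJc : differentiable (J_in c) (cmap c x) := J_in_differentiable Ux.
have JJ z : D z -> J_in c z *m J_in c z = - 1%:M.
  move=> [y [[Uy _] cy] <-]; have [ca ya] := covM y.
  have [_ /(_ _ Uy)[JJ _]] := aJ; have uT := transition_unit rM cc ca cy ya.
  rewrite (J_in_cmap cc cy) !mulmxA -(mulmxA _ (transition _ _ _) (invmx _)).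
  rewrite (mulmxV uT) mulmx1 -(mulmxA _ (J y) (J y)) JJ mulmxN mulmx1 mulNmx.
  by rewrite mulVmx.
have JGJ z : D z -> (J_in c z)^T *m G z *m J_in c z = G z.
  move=> [y [[Uy _] cy] <-]; have [ca ya] := covM y.
  have [_ /(_ _ Uy)[_ O]] := aJ; have uT := transition_unit rM cc ca cy ya.
  rewrite (J_in_cmap cc cy) /G (metric_in_cmap g rM cc cy).
  set T := transition _ _ _ in uT *; rewrite !trmx_mul !mulmxA.
  have eT : (invmx T)^T *m T^T = 1%:M by rewrite -trmx_mul mulmxV // trmx1.
  rewrite -(mulmxA _ (invmx T)^T T^T) eT mulmx1.
  rewrite -(mulmxA _ T (invmx T)) mulmxV // mulmx1.
  transitivity (T^T *m ((J y)^T *m g y *m J y) *m T); first by rewrite !mulmxA.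
  by rewrite O.
have FJ z : D z -> jac F z *m J_in c z = J0 R 1 *m jac F z.
  move=> [y [[Uy [Vy cy']] cy] <-]; have [ca ya] := covM y.
  have [cb fb] := covN (f y); have uT := transition_unit rM cc ca cy ya.
  have uT' := transition_unit rN cc' cb cy' fb.
  have E := jac_charts rM rN smf Uy cc cc' cy cy'.
  have [_ /(_ _ _ _ cc' cb cy' fb) E2] := cN.
  have E3 : jac F (cmap c y) = invmx (transition c' (chart_at AN (f y)) (f y)) *m
      (mdiff AM AN f y *m transition c (chart_at AM y) y).
    by rewrite -E mulmxA mulVmx // mul1mx.
  have E4 : mdiff AM AN f y *m J y = J0 R 1 *m mdiff AM AN f y.
    by apply: mulmx_cV_inj => v; rewrite -!mulmxA fJ.
  rewrite E3 (J_in_cmap cc cy) !mulmxA.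
  rewrite -(mulmxA _ (transition c _ y) (invmx _)) mulmxV // mulmx1.
  rewrite -(mulmxA _ (mdiff _ _ _ _) (J y)) E4 !mulmxA; do 2 congr (_ *m _).
  rewrite -[RHS]mul1mx -(mulVmx uT') -!mulmxA [_ *m (J0 R 1 *m _)]mulmxA E2.
  by rewrite -mulmxA mulmxV // mulmx1.
have jacFx : jac F (cmap c x) = mdiff AM AN f x by [].
have EJx : J_in c (cmap c x) = J x.
  by rewrite (J_in_cmap cc cx) (transition_refl rM cc cx) invmx1 mul1mx mulmx1.
have flat : flat_laplacian phi (F (cmap c x)) = 0.
  rewrite Fx.
  have Dfx : D' (cmap c' (f x)) by exists (f x).
  have oD' : open D' by exact: (oVc _ cc').
  have D'c z : D' z -> (cmap c' @` cdom c') z by move=> [y [_ cy] <-]; exists y.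
  apply: (conformal_laplacian (G := metric_in AN k c') oD' Dfx).
  - exact: (metric_in_differentiable rk cc' (D'c _ Dfx)).
  - by move=> z /D'c; exact: metric_in_sym.
  - by move=> v; exact: (metric_in_pos rN rk cc' (D'c _ Dfx)).
  - by move=> z /D'c; exact: metric_in_conformal.
  exact: hu (f x) Vx.
have K := @chart_laplacian R d D D' F phi (cmap c x) oD Dx FD sFD sphi G (J_in c)
  (metric_in_differentiable rg cc (DcM _ Dx)) dJc
  (fun z Dz => metric_in_sym rM rg cc (DcM z Dz))
  (fun v => @metric_in_pos _ _ _ _ _ rM rg _ cc _ v (DcM _ Dx)) JJ JGJ FJ
  (surf Ux).
apply: etrans _ (K _ _ flat).
- apply: (metric_laplacian_ext G oD Dx) => _ [y [[Uy [Vy cy']] cy] <-].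
  by rewrite /phi /F /in_charts /= (iM cc cy) (iN cc' cy').
- by move=> X fX; rewrite -(nabla_chart X Ux); exact: kerJ.
by move=> X; rewrite EJx -!(nabla_chart _ Ux); exact: holJ.
Qed.

Lemma surface_harmonic_morphism : harmonic_morphism AM g AN k U f.
Proof. by split => // V u; exact: harmonic_pullback. Qed.

End HarmonicMorphism.

(** * The theorem *)

Unset Implicit Arguments.

Theorem mainTheorem5 (R : realType) (n p : nat) (N P M : topologicalType)
    (AN : atlas R (n + n) N) (AP : atlas R (p + p) P)
    (AM : atlas R ((n + p) + (n + p)) M)
    (g : M -> 'M[R]_((n + p) + (n + p)))
    (W : set (N * P)) (H : N * P -> M * 'M[R]_((n + p) + (n + p)))
    (hinv : M -> N * P) :
  complex_manifold AN -> complex_manifold AP ->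
  is_manifold AM -> oriented_atlas AM -> riemannian_metric AM g ->
  open W ->
  J1_holomorphic AM g (prod_atlas AN AP) (fun _ v => prodJ R n p *m v) W H ->
  (forall z : N,
     horizontal_map AM g AP [set xi | W (z, xi)] (fun xi => H (z, xi))) ->
  let h : N * P -> M := fun w => (H w).1 in
  diffeo_onto_image (prod_atlas AN AP) AM W h hinv ->
  let hW : set M := h @` W in
  let J : M -> 'M[R]_((n + p) + (n + p)) := fun x => (H (hinv x)).2 in
  let f : M -> N := fun x => (hinv x).1 in
  [/\ hermitian_structure AM g hW J,
      holomorphic AM AN (fun x v => J x *m v) (fun _ v => J0 R n *m v) hW f,
      forall z : N, superminimal AM g J (hW `&` f @^-1` [set z]) &
      n = 1%N ->
      forall k : N -> 'M[R]_(n + n),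
        riemannian_metric AN k ->
        (forall z, orthogonal_at k z (J0 R n)) ->
        harmonic_morphism AM g AN k hW f].
Proof.
move=> cN cP mM _ rg _ hol hor h dif hW J f.
have holf := projection_holomorphic cN cP mM hol dif.
have herm := section_hermitian cN cP mM hol dif.
split; [exact: herm | exact: holf | exact: (fibre_superminimal cN cP mM hol hor dif) |].
(* A surface: the general result on holomorphic maps with superminimal fibres. *)
move=> n1; subst n => k rk ok.
have [smf fJ] := holf; have [aJ _] := herm.
apply: (surface_harmonic_morphism cN (manifold_regular mM) rg smf aJ _ _ _ _ rk ok).
- by move=> x v hx; exact: fJ.
- by move=> x hx; exact: (projection_submersive cN cP mM dif hx).
- by move=> x X hx fX; exact: (nabla_vertical cN cP mM hol hor dif hx fX).
by move=> x X hx; exact: (nabla_holomorphic cN cP mM hol dif X hx).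
Qed.
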